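(* Let $M\ge 1$ be an integer, $T>0$, $N$ a positive integer, and set $\Delta t = T/N$. Suppose that for each $m$ with $1\le m\le M-1$ one is given a quadrature scheme with positive weights $w_{m,1},\dots,w_{m,Q_m}>0$ and nodes $\boldsymbol{s}^{m,1},\dots,\boldsymbol{s}^{m,Q_m}\in\mathfrak{C}_m$ satisfying the exactness condition $$\sum_{q=1}^{Q_m} w_{m,q}\prod_{j=0}^{m}\big(s^{m,q}_{j+1}-s^{m,q}_j\big)^{\gamma_j}=\int_{\mathfrak{C}_m}\prod_{j=0}^{m}(s_{j+1}-s_j)^{\gamma_j}\,\mathrm{d}s_1\cdots\mathrm{d}s_m\quad\text{for all }(\gamma_0,\dots,\gamma_m)\in\mathbb{Z}_{\ge0}^{m+1}\text{ with }\sum_{j=0}^m\gamma_j\le M-m.$$ Let $\mathcal{A}^{(M)}_{\Delta t}$ be the normalized structure-preserving scheme of order $M$ built from these quadratures (defined in the context). Assume $\Delta t=\frac{T}{N}\le \frac{1}{\|J\|_\infty}$. Then for every density matrix $\rho$, $$\Big\|\big(\mathcal{A}^{(M)}_{T/N}\big)^{N}(\rho)-e^{T\mathcal{L}}(\rho)\Big\|_1\le c_M\,\frac{T^{M+1}}{N^M},$$ where $$c_M=\frac{46}{(M+1)!}\big(\|J\|_\infty+\|\mathcal{L}_L\|_1\big)^{M+1}+\sum_{m=1}^{M-1}\frac{4(M-m)!}{M!}\,C(M,m)\,\|\mathcal{L}_L\|_1^{m}\,\|J\|_\infty^{M-m+1},$$ $$C(M,m)=\sum_{\substack{0\le x_1,\dots,x_{2m+2}\le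 M-m\\ \sum_{j=1}^{2m+2}x_j\ge M-m+1}}\frac{1}{\prod_{j=1}^{2m+2}x_j!}$$ (the $x_j$ are integers, and for $M=1$ the sum $\sum_{m=1}^{M-1}$ is zero).
   Context: Let $\mathsf{d}<\infty$ and work with complex $\mathsf{d}\times\mathsf{d}$ matrices. A density matrix is a positive semidefinite matrix of trace one. Let $H$ be Hermitian and $L_1,\dots,L_\varkappa$ arbitrary $\mathsf{d}\times\mathsf{d}$ matrices. The Lindblad superoperator is $$\mathcal{L}(\rho)=-i[H,\rho]+\sum_{k=1}^{\varkappa}\Big(L_k\rho L_k^\dagger-\tfrac12\big(L_k^\dagger L_k\rho+\rho L_k^\dagger L_k\big)\Big).$$ Set $H_{\mathrm{eff}}=H+\frac{1}{2i}\sum_{k}L_k^\dagger L_k$, $J=-iH_{\mathrm{eff}}$, and $\mathcal{L}_L(\rho)=\sum_k L_k\rho L_k^\dagger$. For a matrix $A$, $\|A\|_p=(\mathrm{tr}|A|^p)^{1/p}$ is the Schatten-$p$ norm ($\|\cdot\|_\infty$ is the operator norm); for a superoperator $\mathcal{B}$, $\|\mathcal{B}\|_1$ is the operator norm induced by the Schatten-1 norm. If $J=0$, $1/\|J\|_\infty$ is read as $+\infty$. For an integer $m\ge0$, $\mathcal{J}_m(t)(\rho)=A\rho A^\dagger$ with $A=\sum_{\alpha=0}^m \frac{J^\alpha t^\alpha}{\alpha!}$. $\mathfrak{C}_m=\{\boldsymbol{s}=(s_1,\dots,s_m): 0\le s_1\le s_2\le\cdots\le s_m\le1\}$, with the conventions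 $s_0=0$, $s_{m+1}=1$ (also for quadrature nodes) and $0^0=1$. For $1\le m\le M$ and $\boldsymbol{s}\in\mathfrak{C}_m$, the superoperator $$\mathcal{F}_m^M(\boldsymbol{s})=\mathcal{J}_{M-m}(\Delta t(1-s_m))\,\mathcal{L}_L\,\mathcal{J}_{M-m}(\Delta t(s_m-s_{m-1}))\,\mathcal{L}_L\cdots\mathcal{J}_{M-m}(\Delta t(s_2-s_1))\,\mathcal{L}_L\,\mathcal{J}_{M-m}(\Delta t\,s_1)$$ (a composition of superoperators). The unnormalized scheme of order $M$ is $$\mathcal{A}^{(\mathrm{un},M)}_{\Delta t}(\rho)=\mathcal{J}_M(\Delta t)(\rho)+\sum_{m=1}^{M-1}\Delta t^m\sum_{q=1}^{Q_m}w_{m,q}\,\mathcal{F}^M_m(\boldsymbol{s}^{m,q})(\rho)+\frac{\Delta t^M}{M!}\mathcal{L}_L^M(\rho),$$ and the normalized scheme is the (nonlinear) map $\mathcal{A}^{(M)}_{\Delta t}(\rho)=\mathcal{A}^{(\mathrm{un},M)}_{\Delta t}(\rho)/\mathrm{tr}\big(\mathcal{A}^{(\mathrm{un},M)}_{\Delta t}(\rho)\big)$. The power $(\cdot)^N$ denotes $N$-fold composition. *)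

(* Defs.v *)
From HB Require Import structures.
From mathcomp Require Import all_boot all_order all_algebra.
From mathcomp Require Import spectral complex.
From mathcomp Require Import all_classical all_reals all_analysis.
Set Implicit Arguments.
Unset Strict Implicit.
Unset Printing Implicit Defensive.
Import Order.TTheory GRing.Theory Num.Theory.
Import numFieldNormedType.Exports.
Local Open Scope classical_set_scope.
Local Open Scope ring_scope.
Local Open Scope sesquilinear_scope.
Local Open Scope complex_scope.

Section norms.
Context {R : realType} {d : nat}.
Local Notation C := R[i].
Implicit Types (A X : 'M[C]_d) (B : 'M[C]_d -> 'M[C]_d).

Definition psdmx A :=
  A \is hermsymmx /\ forall v : 'cV[C]_d, 0 <= (v^t* *m A *m v) 0 0.

Definition density_matrix A := psdmx A /\ \tr A = 1.

(* |A| = sqrt(A^* A), through the spectral decomposition of A^* A. *)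
Definition absmx A : 'M[C]_d :=
  let P := spectralmx (A^t* *m A) in
  invmx P *m diag_mx (map_mx sqrtC (spectral_diag (A^t* *m A))) *m P.

Definition schatten1 A : R := complex.Re (\tr (absmx A)).

Definition euclid_norm (v : 'cV[C]_d) : R :=
  Num.sqrt (\sum_i Normc.normc (v i 0) ^+ 2).

(* sup is junk (0) on unbounded sets; here the set is nonempty and bounded, and
   so is the one in superop_norm1 whenever B is linear. *)
Definition opnorm A : R :=
  sup [set euclid_norm (A *m v) | v in [set v | euclid_norm v <= 1]].

Definition superop_norm1 B : R :=
  sup [set schatten1 (B X) | X in [set X | schatten1 X <= 1]].

(* e^(tB) X, as the limit of the exponential series applied to X. *)
Definition expsuperop (t : R) B X : 'M[C]_d :=
  limn (series (fun n => (t ^+ n / n`!%:R)%:C *: iter n B X)).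
End norms.

Section lindblad.
Context {R : realType} {d k : nat}.
Local Notation C := R[i].
Variables (H : 'M[C]_d) (L : 'I_k -> 'M[C]_d).
Implicit Types X : 'M[C]_d.

Definition lindblad X : 'M[C]_d :=
  - 'i *: (H *m X - X *m H)
  + \sum_j (L j *m X *m (L j)^t*
            - 2^-1 *: ((L j)^t* *m L j *m X + X *m ((L j)^t* *m L j))).

Definition Heff : 'M[C]_d := H + (2 * 'i)^-1 *: \sum_j ((L j)^t* *m L j).

Definition Jeff : 'M[C]_d := - 'i *: Heff.

Definition jumps X : 'M[C]_d := \sum_j (L j *m X *m (L j)^t*).

End lindblad.

Section simplex.
Context {R : realType}.
Local Notation Rm := (measurableTypeR R).

(* knot s j = s_j for 0 <= j <= m + 1, with s_0 = 0 and s_(m+1) = 1; the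
   entries s_1, ..., s_m of the tuple sit at the shifted positions 0, ..., m-1. *)
Definition knot m (s : m.-tuple R) (j : nat) : R := nth 0 (0 :: rcons s 1) j.

Definition gap m (s : m.-tuple R) (j : nat) : R := knot s j.+1 - knot s j.

Definition simplex m : set (m.-tuple R) :=
  [set s | forall j, (j <= m)%N -> knot s j <= knot s j.+1].

Definition tcons m (p : Rm * m.-tuple Rm) : m.+1.-tuple Rm :=
  [tuple of p.1 :: p.2].

Lemma measurable_tcons m : measurable_fun setT (@tcons m).
Proof. exact: (measurable_cons measurable_fst measurable_snd). Qed.

Section lebesgue_tcons.
Context {m : nat} (mu : {sigma_finite_measure set (m.-tuple Rm) -> \bar R}).

(* mu plays the role of the m-dimensional Lebesgue measure: lebesgue_tcons mu is
   the product measure, carried from R * m.-tuple R over to m.+1.-tuple R. *)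
Definition lebesgue_tcons : set (m.+1.-tuple Rm) -> \bar R :=
  pushforward (@lebesgue_measure R \x mu)%E (@tcons m).

Let pre A : measurable A -> measurable (@tcons m @^-1` A).
Proof.
by move=> mA; rewrite -[X in measurable X]setTI; exact: measurable_tcons.
Qed.

Let lebesgue_tcons0 : lebesgue_tcons set0 = 0%E.
Proof. by rewrite /lebesgue_tcons /pushforward preimage_set0 measure0. Qed.

Let lebesgue_tcons_ge0 A : (0 <= lebesgue_tcons A)%E.
Proof. by rewrite /lebesgue_tcons /pushforward; exact: measure_ge0. Qed.

Let lebesgue_tcons_sigma_additive : semi_sigma_additive lebesgue_tcons.
Proof.
move=> F mF tF mUF; rewrite /lebesgue_tcons /pushforward preimage_bigcup.
apply: measure_semi_sigma_additive.
- by move=> n; exact: pre.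
- apply/trivIsetP => /= i j _ _ ij; rewrite -preimage_setI.
  by move/trivIsetP : tF => /(_ _ _ _ _ ij) ->//; rewrite preimage_set0.
- by rewrite -preimage_bigcup; exact: pre.
Qed.

HB.instance Definition _ := isMeasure.Build _ _ _ lebesgue_tcons
  lebesgue_tcons0 lebesgue_tcons_ge0 lebesgue_tcons_sigma_additive.

Let lebesgue_tcons_sigma_finite : sigma_finite setT lebesgue_tcons.
Proof.
have /sigma_finiteP[F [FT ndF Foo]] := sigma_finiteT (@lebesgue_measure R).
have /sigma_finiteP[G [GT ndG Goo]] := sigma_finiteT mu.
pose u (s : m.+1.-tuple Rm) : Rm * m.-tuple Rm :=
  (tnth s ord0, [tuple of behead s]).
have tK p : u (tcons p) = p.
  by case: p => x s; congr pair; exact: val_inj.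
have mu_ : measurable_fun setT u.
  apply/measurable_fun_pair; [exact: measurable_tnth|exact: measurable_behead].
exists (fun n => u @^-1` (F n `*` G n)).
  rewrite -preimage_bigcup (_ : \bigcup_n _ = setT) ?preimage_setT//.
  rewrite -setXTT FT GT predeqE => -[x y]; split.
    by move=> [n _ []/= ? ?]; split; exists n.
  move=> [/= [n _ Fnx] [k _ Gky]]; exists (maxn n k) => //; split.
  - by move: x Fnx; exact/subsetPset/ndF/leq_maxl.
  - by move: y Gky; exact/subsetPset/ndG/leq_maxr.
move=> n; have [mF Fn] := Foo n; have [mG Gn] := Goo n; split.
  rewrite -[X in measurable X]setTI; apply: mu_ => //.
  exact: measurableX.
rewrite /lebesgue_tcons /pushforward.
rewrite (_ : _ @^-1` _ = F n `*` G n); last first.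
  by apply/funext => p /=; rewrite -[in RHS](tK p).
by rewrite product_measure1E// lte_mul_pinfty// ge0_fin_numE.
Qed.

HB.instance Definition _ := @Measure_isSigmaFinite.Build _ _ _
  lebesgue_tcons lebesgue_tcons_sigma_finite.

End lebesgue_tcons.

(* m-dimensional Lebesgue measure, on the product sigma-algebra. *)
Fixpoint lebesgue_tuple m :
    {sigma_finite_measure set (m.-tuple Rm) -> \bar R} :=
  match m with
  | 0 => \d_[tuple]
  | m'.+1 => lebesgue_tcons (lebesgue_tuple m')
  end.

End simplex.

(* n is the degree of exactness, M - m in the scheme of order M. *)
Definition exact_quadrature (R : realType) (m n Qm : nat)
    (w : 'I_Qm -> R) (s : 'I_Qm -> m.-tuple R) :=
  forall g : 'I_m.+1 -> nat, (\sum_j g j <= n)%N ->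
    (\sum_q w q * \prod_(j < m.+1) gap (s q) j ^+ g j)%:E
    = (\int[lebesgue_tuple m]_(x in @simplex R m)
         (\prod_(j < m.+1) gap x j ^+ g j)%:E)%E.

Section scheme.
Context {R : realType} {d k : nat}.
Local Notation C := R[i].
Variables (H : 'M[C]_d) (L : 'I_k -> 'M[C]_d).
Local Notation J := (Jeff H L).
Local Notation LL := (jumps L).
Implicit Types (X : 'M[C]_d) (dt t : R).

(* In powers of J, ^+ is the ring power of 'M_d, i.e. iterated mulmx. *)
Definition truncated_flow (n : nat) t X : 'M[C]_d :=
  let A := \sum_(a < n.+1) (t ^+ a / a`!%:R)%:C *: J ^+ a in
  A *m X *m A^t*.

(* iteri composes from the innermost (earliest) factor outwards: step j applies
   the jump part, then the flow over the gap s_(j+2) - s_(j+1). *)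
Definition jump_chain (M m : nat) dt (s : m.-tuple R) X : 'M[C]_d :=
  iteri m (fun j Y => truncated_flow (M - m) (dt * gap s j.+1) (LL Y))
    (truncated_flow (M - m) (dt * gap s 0) X).

Variables (Q : nat -> nat) (w : forall m, 'I_(Q m) -> R)
  (s : forall m, 'I_(Q m) -> m.-tuple R).

Definition unnormalized_scheme (M : nat) dt X : 'M[C]_d :=
  truncated_flow M dt X
  + \sum_(1 <= m < M) (dt ^+ m)%:C *:
      (\sum_(q < Q m) (w q)%:C *: jump_chain M dt (s q) X)
  + (dt ^+ M / M`!%:R)%:C *: iter M LL X.

Definition normalized_scheme (M : nat) dt X : 'M[C]_d :=
  let Y := unnormalized_scheme M dt X in (\tr Y)^-1 *: Y.

Definition combC (M m : nat) : R :=
  \sum_(x : {ffun 'I_(2 * m + 2) -> 'I_(M - m).+1}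
          | (M - m + 1 <= \sum_j x j)%N)
    ((\prod_j (x j)`!)%:R)^-1.

Definition error_const (M : nat) : R :=
  46 / (M.+1)`!%:R * (opnorm J + superop_norm1 LL) ^+ M.+1
  + \sum_(1 <= m < M)
      4 * (M - m)`!%:R / M`!%:R * combC M m
        * superop_norm1 LL ^+ m * opnorm J ^+ (M - m + 1).

End scheme.

(* Main.v *)
Require Import Defs.
From mathcomp Require Import all_boot all_order all_algebra.
From mathcomp Require Import spectral complex.
From mathcomp Require Import all_classical all_reals all_analysis.
From mathcomp Require Import measurable_realfun.
From mathcomp Require Import ring lra zify.
Set Implicit Arguments.
Unset Strict Implicit.
Unset Printing Implicit Defensive.
Import Order.TTheory GRing.Theory Num.Theory.
Import numFieldNormedType.Exports.
Local Open Scope classical_set_scope.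
Local Open Scope ring_scope.
Local Open Scope sesquilinear_scope.
Local Open Scope complex_scope.

(** Let A and B be the multiplications by J on the left and by J^t* on the right,
    and Lam the jump part, so that the generator G is A + B + Lam.  The exact flow
    exp (dt G) and one step of the unnormalized scheme are both sums of words in
    these letters.  As A and B commute, a word with m jumps is given by the
    exponents (a_i, b_i) of its m + 1 blocks A^a_i B^b_i.  In the exponential
    series its coefficient is dt^n I / (prod a_i! b_i!), where n is the number of
    letters, I = (prod c_i!) / n! and c_i = a_i + b_i; and I is the integral over
    the simplex of the monomial prod (s_(i+1) - s_i)^c_i
    (integral_simplex_gaps, prod_binomsE).  In the scheme, I is replaced with the
    quadrature of the same monomial.  Thus only scalar integrals are needed, and
    the local error has two parts.

    - Words that occur in the scheme.  By exactness the coefficients agree when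
      the sum of the c_i is at most M - m.  Beyond, both the integral and the
      quadrature are at most (M - m)! / M!, because the gaps lie in [0, 1] and
      the quadrature is exact after lowering some exponents
      (quad_dirichlet_high).  The sum over these words is the constant combC
      (chain_error, combC_boxes).

    - Words that do not occur in the scheme: some exponent exceeds M - m, or
      there are more than M jumps.  They have at least M + 1 letters, and they
      are counted in jumped_below_bound and jumped_bound.  Since dt |J| <= 1, and
      since the norm of Lam is at most 2 |J| (jumps_norm1_le), they contribute at
      most 23 / (M + 1)! (dt |J| + dt |Lam|)^(M + 1).

    For the global error, exp (t G) preserves the trace, and it preserves
    positivity as a limit of steps (1 + h J) X (1 + h J)^t* + h Lam X; hence it
    contracts the trace norm on Hermitian matrices (exp_contraction).  The
    unnormalized step also preserves positivity, and its trace is 1 up to the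
    local error, so that normalizing at most doubles the local error, and the
    errors of the N steps add up (normalized_step, global_error).  The doubling
    turns 23 into 46.

    The trace norm is accessed through its dual description as a maximum of
    tr (W X) over contractions W (normc_tr_le, schatten1_dual). *)

Local Notation normc := Normc.normc.

(** * Complex moduli and Euclidean norms *)

Section euclid.
Context {R : realType} {d : nat}.
Local Notation C := R[i].
Implicit Types (a b v : 'cV[C]_d) (z : C).

Lemma norm_normc z : `|z| = (normc z)%:C. Proof. by []. Qed.

Lemma normc_ge0 z : 0 <= normc z.
Proof. by rewrite -lecR; exact: (normr_ge0 z). Qed.

Lemma normc_conj z : normc (Num.conj z) = normc z.
Proof. by apply: complexI; exact: (norm_conjC z). Qed.

Lemma normc_real (t : R) : normc t%:C = `|t|.
Proof. by rewrite /= expr0n addr0 sqrtr_sqr. Qed.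

Lemma normc_sum (I : Type) (r : seq I) (P : pred I) (F : I -> C) :
  normc (\sum_(i <- r | P i) F i) <= \sum_(i <- r | P i) normc (F i).
Proof.
elim/big_ind2: _ => [|x u y v hx hy|//]; first by rewrite Normc.normc0.
exact: le_trans (le_normcD _ _) (lerD hx hy).
Qed.

Lemma normc_Re_Im z : normc z <= `|complex.Re z| + `|complex.Im z|.
Proof.
case: z => x y /=; rewrite -(@ler_pXn2r _ 2) ?nnegrE ?sqrtr_ge0 ?addr_ge0//.
rewrite sqr_sqrtr ?addr_ge0 ?sqr_ge0// sqrrD !real_normK ?num_real//.
by have := mulr_ge0 (normr_ge0 x) (normr_ge0 y); rewrite mulr2n; lra.
Qed.

Lemma abs_Re_le z : `|complex.Re z| <= normc z.
Proof. by case: z => x y /=; rewrite -sqrtr_sqr ler_wsqrtr// lerDl sqr_ge0. Qed.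

Lemma abs_Im_le z : `|complex.Im z| <= normc z.
Proof. by case: z => x y /=; rewrite -sqrtr_sqr ler_wsqrtr// lerDr sqr_ge0. Qed.

Lemma Re_le_normc z : complex.Re z <= normc z.
Proof. exact: le_trans (ler_norm _) (abs_Re_le z). Qed.

Lemma euclid_ge0 v : 0 <= euclid_norm v. Proof. exact: sqrtr_ge0. Qed.

Lemma euclid_sqr a : (a^t* *m a) 0 0 = (euclid_norm a ^+ 2)%:C.
Proof.
rewrite !mxE sqr_sqrtr; last by apply: sumr_ge0 => i _; exact: sqr_ge0.
rewrite rmorph_sum; apply: eq_bigr => i _.
by rewrite !mxE rmorphXn /= -norm_normc mulrC -normCK.
Qed.

Lemma euclid0 : euclid_norm (0 : 'cV[C]_d) = 0.
Proof.
rewrite /euclid_norm big1 ?sqrtr0// => i _.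
by rewrite mxE Normc.normc0 expr0n.
Qed.

Lemma euclid_eq0 v : euclid_norm v = 0 -> v = 0.
Proof.
move=> /eqP; rewrite sqrtr_eq0 => le0; apply/colP => i; rewrite mxE.
apply: Normc.eq0_normc; apply/eqP; rewrite -sqrf_eq0 eq_le sqr_ge0 andbT.
rewrite (le_trans _ le0)// (bigD1 i)//= lerDl.
by apply: sumr_ge0 => j _; exact: sqr_ge0.
Qed.

Lemma euclidZ z v : euclid_norm (z *: v) = normc z * euclid_norm v.
Proof.
rewrite /euclid_norm -[normc z]ger0_norm ?normc_ge0// -sqrtr_sqr.
rewrite -sqrtrM ?sqr_ge0// mulr_sumr; congr Num.sqrt; apply: eq_bigr => i _.
by rewrite mxE Normc.normcM exprMn.
Qed.

Lemma normc_dot_le a b :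
  normc ((a^t* *m b) 0 0) <= euclid_norm a * euclid_norm b.
Proof.
have E (u v : 'cV[C]_d) : dotmx u^T v^T = (v^t* *m u) 0 0.
  by rewrite dotmxE !mxE; apply: eq_bigr => i _; rewrite !mxE mulrC.
have : `|dotmx b^T a^T| ^+ 2 <= dotmx b^T b^T * dotmx a^T a^T.
  by have [] := CauchySchwarz (@dotmx C d) b^T a^T.
rewrite !E !euclid_sqr norm_normc -rmorphM -rmorphXn lecR.
rewrite -exprMn ler_pXn2r ?nnegrE// ?mulr_ge0 ?euclid_ge0 ?normc_ge0//.
by rewrite [euclid_norm b * _]mulrC.
Qed.
End euclid.

Section opbound.
Context {R : realType} {d : nat}.
Local Notation C := R[i].
Implicit Types (a b v : 'cV[C]_d) (W A : 'M[C]_d) (c : R).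

(** Boundedness as a sesquilinear form, rather than through the norm of W v, is
    visibly stable under taking adjoints. *)
Definition opbounded W c :=
  forall a b, normc ((a^t* *m W *m b) 0 0) <= c * (euclid_norm a * euclid_norm b).

Lemma opboundedP W c : 0 <= c ->
  (forall v, euclid_norm (W *m v) <= c * euclid_norm v) -> opbounded W c.
Proof.
move=> c0 Wc a b; rewrite -mulmxA (le_trans (normc_dot_le _ _))//.
by rewrite mulrCA ler_wpM2l ?euclid_ge0.
Qed.

Lemma adjmxM (m n p : nat) (X : 'M[C]_(m, n)) (Y : 'M[C]_(n, p)) :
  (X *m Y)^t* = Y^t* *m X^t*.
Proof. by rewrite trmx_mul map_mxM. Qed.

Lemma opbounded_adj W c : opbounded W c -> opbounded (W^t* ) c.
Proof.
move=> Wc a b; have := Wc b a; rewrite -normc_conj mulrC [in X in _ -> X]mulrC.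
rewrite [euclid_norm b * _]mulrC.
have -> // : Num.conj ((b^t* *m W *m a) 0 0) = (a^t* *m W^t* *m b) 0 0.
have -> : a^t* *m W^t* *m b = (b^t* *m W *m a)^t*.
  by rewrite !adjmxM trmxCK mulmxA.
by rewrite [RHS]mxE [in RHS]mxE.
Qed.

(** The form is tested on W v and v, and one factor of the norm of W v cancels. *)
Lemma opbounded_euclid W c v : opbounded W c -> euclid_norm (W *m v) <= c * euclid_norm v.
Proof.
move=> Wc; have := Wc (W *m v) v; rewrite -mulmxA euclid_sqr normc_real.
rewrite ger0_norm ?sqr_ge0// => le1.
have [W0|W0] := eqVneq (euclid_norm (W *m v)) 0.
  have [/euclid_eq0 ->|v0] := eqVneq (euclid_norm v) 0.
    by rewrite mulmx0 euclid0 mulr0.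
  have := Wc v v; rewrite (euclid_eq0 W0) -mulmxA (euclid_eq0 W0) mulmx0 mxE.
  rewrite Normc.normc0 mulrA euclid0 pmulr_lge0// lt_def v0 euclid_ge0//.
rewrite -(@ler_pM2r _ (euclid_norm (W *m v))) ?lt_def ?W0 ?euclid_ge0//.
by rewrite -expr2 -mulrA [euclid_norm v * _]mulrC.
Qed.

Lemma opboundedM W A c1 c2 : 0 <= c1 -> opbounded W c1 -> opbounded A c2 ->
  opbounded (W *m A) (c1 * c2).
Proof.
move=> c10 Wc Ac a b; rewrite mulmxA -mulmxA.
have -> : a^t* *m W = (W^t* *m a)^t* by rewrite adjmxM trmxCK.
apply: le_trans (normc_dot_le _ _) _.
have := ler_pM (euclid_ge0 _) (euclid_ge0 _)
  (opbounded_euclid a (opbounded_adj Wc)) (opbounded_euclid b Ac).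
by rewrite mulrACA.
Qed.

Lemma opbounded1 : opbounded 1%:M 1.
Proof. by move=> a b; rewrite mulmx1 mul1r normc_dot_le. Qed.

Lemma opboundedD W1 W2 c1 c2 : opbounded W1 c1 -> opbounded W2 c2 -> opbounded (W1 + W2) (c1 + c2).
Proof.
move=> h1 h2 a b; rewrite mulmxDr mulmxDl mxE mulrDl.
exact: le_trans (le_normcD _ _) (lerD (h1 _ _) (h2 _ _)).
Qed.

Lemma opboundedN W c : opbounded W c -> opbounded (- W) c.
Proof. by move=> h a b; rewrite mulmxN mulNmx mxE normcN. Qed.

End opbound.

(** * The trace norm by duality *)

Section schatten.
Context {R : realType} {d : nat}.
Local Notation C := R[i].
Implicit Types (a b v : 'cV[C]_d) (W A X Y : 'M[C]_d) (c : R).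

Let P X := spectralmx (X^t* *m X).

Lemma gram_herm X : X^t* *m X \is hermsymmx.
Proof. by apply/is_hermitianmxP; rewrite expr0 scale1r adjmxM trmxCK. Qed.

Lemma spectral_unitary A : spectralmx A *m (spectralmx A)^t* = 1%:M.
Proof. exact/unitarymxP/spectral_unitarymx. Qed.

Lemma spectral_unitaryV A : (spectralmx A)^t* *m spectralmx A = 1%:M.
Proof. exact: mulmx1C (spectral_unitary A). Qed.

Lemma herm_spectral A : A \is hermsymmx ->
  A = (spectralmx A)^t* *m diag_mx (spectral_diag A) *m spectralmx A.
Proof.
move=> /hermitian_normalmx/orthomx_spectralP {1}->.
by rewrite invmx_unitary ?spectral_unitarymx.
Qed.

(** The images X v_i of an orthonormal eigenbasis v_i of X^t* X; they are pairwise
    orthogonal, and their lengths are the singular values of X. *)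
Let eigcols X := X *m (P X)^t*.

Lemma gram_diag X :
  (eigcols X)^t* *m eigcols X = diag_mx (spectral_diag (X^t* *m X)).
Proof.
rewrite /eigcols adjmxM trmxCK mulmxA -(mulmxA (P X)).
have := herm_spectral (gram_herm X); rewrite -/(P X).
move: (diag_mx (spectral_diag (X^t* *m X))) => D ->.
by rewrite !mulmxA spectral_unitary mul1mx -mulmxA spectral_unitary mulmx1.
Qed.

Lemma gram_eigenvalue X i :
  spectral_diag (X^t* *m X) 0 i = (euclid_norm (col i (eigcols X)) ^+ 2)%:C.
Proof.
have /matrixP/(_ i i) := gram_diag X.
rewrite [in RHS]mxE eqxx mulr1n => <-; rewrite -euclid_sqr !mxE.
by apply: eq_bigr => j _; rewrite !mxE.
Qed.

Lemma schatten1E X : schatten1 X = \sum_i euclid_norm (col i (eigcols X)).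
Proof.
rewrite /schatten1 /absmx -/(P X) invmx_unitary ?spectral_unitarymx//.
rewrite mxtrace_mulC mulmxA spectral_unitary mul1mx mxtrace_diag.
rewrite (raddf_sum (@complex.Re R)); apply: eq_bigr => i _.
by rewrite mxE gram_eigenvalue rmorphXn /= sqrCK ?lecR ?euclid_ge0.
Qed.

Lemma schatten1_ge0 X : 0 <= schatten1 X.
Proof. by rewrite schatten1E sumr_ge0// => i _; exact: euclid_ge0. Qed.

Lemma euclid_col_unitary (U : 'M[C]_d) i :
  U *m U^t* = 1%:M -> euclid_norm (col i (U^t* )) = 1.
Proof.
move=> U1; apply/eqP; rewrite -(@pexpr_eq1 _ _ 2) ?euclid_ge0//; apply/eqP.
apply: complexI; rewrite -euclid_sqr rmorph1.
have /matrixP/(_ i i) := U1; rewrite [in RHS]mxE eqxx mulr1n => <-.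
by rewrite !mxE; apply: eq_bigr => j _; rewrite !mxE conjCK.
Qed.

Lemma euclid_isometry (U : 'M[C]_d) v : U^t* *m U = 1%:M ->
  euclid_norm (U *m v) = euclid_norm v.
Proof.
move=> U1; apply/eqP; rewrite -(@eqrXn2 _ 2) ?euclid_ge0//; apply/eqP.
apply: complexI; rewrite -!euclid_sqr adjmxM -mulmxA (mulmxA _ U) U1.
by rewrite mul1mx.
Qed.

(** In the eigenbasis v_i of X^t* X the trace is the sum of the numbers
    v_i^t* W (X v_i). *)
Lemma normc_tr_le W c X : opbounded W c -> normc (\tr (W *m X)) <= c * schatten1 X.
Proof.
move=> Wc.
have -> : W *m X = W *m eigcols X *m P X.
  by rewrite /eigcols -!mulmxA spectral_unitaryV mulmx1.
rewrite mxtrace_mulC mulmxA schatten1E mulr_sumr (le_trans (normc_sum _ _ _))//.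
apply: ler_sum => i _.
have -> : (P X *m W *m eigcols X) i i =
    ((col i ((P X)^t* ))^t* *m W *m col i (eigcols X)) 0 0.
  rewrite -!mulmxA !mxE; apply: eq_bigr => j _; rewrite !mxE conjCK.
  by congr (_ * _); apply: eq_bigr => l _; rewrite !mxE.
by rewrite (le_trans (Wc _ _))// euclid_col_unitary ?spectral_unitary// mul1r.
Qed.

(** The witness is the adjoint of the partial isometry of the polar
    decomposition: it sends X v_i back to its length times v_i, and kills the
    vectors orthogonal to all of them.  With the previous lemma, the trace norm
    is the maximum of tr (W X) over contractions W, from which the triangle
    inequality and the ideal property follow. *)
Lemma schatten1_dual X :
  exists2 W, opbounded W 1 & (schatten1 X)%:C = \tr (W *m X).
Proof.
pose e i := euclid_norm (col i (eigcols X)).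
pose Z := eigcols X *m diag_mx (\row_i ((e i)^-1)%:C).
have tcD : (diag_mx (\row_i ((e i)^-1)%:C) : 'M[C]_d)^t* =
    diag_mx (\row_i ((e i)^-1)%:C).
  rewrite tr_diag_mx map_diag_mx; congr diag_mx; apply/rowP => i.
  by rewrite !mxE; exact: conjc_real.
have ZY : Z^t* *m eigcols X = diag_mx (\row_i (e i)%:C).
  rewrite adjmxM tcD -mulmxA gram_diag mulmx_diag; congr diag_mx.
  apply/rowP => i; rewrite !mxE gram_eigenvalue -/(e i) -rmorphM; congr (_%:C).
  have [->|e0] := eqVneq (e i) 0; first by rewrite expr0n mulr0.
  by rewrite expr2 mulKf.
have ZZ : Z^t* *m Z = diag_mx (\row_i ((e i != 0)%:R)%:C).
  rewrite mulmxA ZY mulmx_diag; congr diag_mx; apply/rowP => i; rewrite !mxE.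
  rewrite -rmorphM; congr (_%:C).
  by have [->|e0] := eqVneq (e i) 0; rewrite ?mul0r ?mulfV.
have Zle v : euclid_norm (Z *m v) <= euclid_norm v.
  rewrite -(@ler_pXn2r _ 2) ?nnegrE ?euclid_ge0// -lecR -!euclid_sqr.
  rewrite adjmxM -mulmxA (mulmxA _ Z) ZZ !mxE; apply: ler_sum => i _.
  rewrite mul_diag_mx !mxE mulrCA; case: eqP => _; rewrite ?mul0r ?mul1r//.
  by rewrite mulrC mul_conjC_ge0.
clearbody Z.
have Ztle v : euclid_norm (Z^t* *m v) <= euclid_norm v.
  have := normc_dot_le v (Z *m (Z^t* *m v)).
  have -> : v^t* *m (Z *m (Z^t* *m v)) = (Z^t* *m v)^t* *m (Z^t* *m v).
    by rewrite adjmxM trmxCK !mulmxA.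
  rewrite euclid_sqr normc_real ger0_norm ?sqr_ge0// => le1.
  have [->|w0] := eqVneq (euclid_norm (Z^t* *m v)) 0; first exact: euclid_ge0.
  rewrite -(@ler_pM2r _ (euclid_norm (Z^t* *m v))) ?lt_def ?w0 ?euclid_ge0//.
  by rewrite -expr2 (le_trans le1)// ler_wpM2l ?euclid_ge0.
exists ((P X)^t* *m Z^t* ); first apply: opboundedP => // v.
  by rewrite mul1r -mulmxA euclid_isometry ?Ztle// trmxCK spectral_unitary.
rewrite -mulmxA mxtrace_mulC -mulmxA -/(eigcols X) ZY mxtrace_diag schatten1E.
by rewrite rmorph_sum; apply: eq_bigr => i _; rewrite mxE.
Qed.

Lemma schatten1_le X c : (forall W, opbounded W 1 -> normc (\tr (W *m X)) <= c) ->
  schatten1 X <= c.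
Proof.
move=> h; have [V /h + E] := schatten1_dual X.
by apply: le_trans; rewrite -E normc_real ler_norm.
Qed.
End schatten.

Lemma maxBN (R : realDomainType) (t : R) : Num.max t 0 - Num.max (- t) 0 = t.
Proof.
have [t0|/ltW t0] := lerP 0 t.
  by rewrite ?(max_l t0) max_r ?oppr_le0// subr0.
by rewrite ?(max_r t0) max_l ?oppr_ge0// sub0r opprK.
Qed.

Lemma maxDN (R : realDomainType) (t : R) : Num.max t 0 + Num.max (- t) 0 = `|t|.
Proof.
have [t0|t0] := ger0P t.
  by rewrite ?(max_l t0) max_r ?oppr_le0// addr0.
by rewrite ?(max_r (ltW t0)) max_l ?oppr_ge0 ?ltW// add0r.
Qed.

Section schatten_norm.
Context {R : realType} {d : nat}.
Local Notation C := R[i].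
Implicit Types (a b v : 'cV[C]_d) (W A X Y : 'M[C]_d) (c : R) (z : C).

Lemma normc_tr_contraction W X : opbounded W 1 -> normc (\tr (W *m X)) <= schatten1 X.
Proof. by move=> W1; rewrite -[leRHS]mul1r normc_tr_le. Qed.

Lemma schatten1D X Y : schatten1 (X + Y) <= schatten1 X + schatten1 Y.
Proof.
apply: schatten1_le => W W1; rewrite mulmxDr mxtraceD.
by rewrite (le_trans (le_normcD _ _))// lerD// normc_tr_contraction.
Qed.

Lemma schatten1Z z X : schatten1 (z *: X) = normc z * schatten1 X.
Proof.
have le w Y : schatten1 (w *: Y) <= normc w * schatten1 Y.
  apply: schatten1_le => W W1; rewrite -scalemxAr mxtraceZ Normc.normcM.
  by rewrite ler_wpM2l ?normc_ge0 ?normc_tr_contraction.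
apply/le_anti; rewrite le /=; have [->|z0] := eqVneq z 0.
  by rewrite Normc.normc0 mul0r schatten1_ge0.
have := le z^-1 (z *: X); rewrite scalerK// Normc.normcV ler_pdivlMl//.
by rewrite lt_def normc_ge0 andbT; apply: contra_neq z0; exact: Normc.eq0_normc.
Qed.

Lemma schatten1Zr (t : R) X : schatten1 (t%:C *: X) = `|t| * schatten1 X.
Proof. by rewrite schatten1Z normc_real. Qed.

Lemma schatten10 : schatten1 (0 : 'M[C]_d) = 0.
Proof. by rewrite -(scale0r 0) schatten1Z Normc.normc0 mul0r. Qed.

Lemma schatten1N X : schatten1 (- X) = schatten1 X.
Proof. by rewrite -scaleN1r schatten1Z normcN Normc.normc1 mul1r. Qed.

Lemma schatten1B X Y : schatten1 (X - Y) <= schatten1 X + schatten1 Y.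
Proof. by rewrite -[schatten1 Y]schatten1N schatten1D. Qed.

Lemma schatten1_sum (I : Type) (r : seq I) (Q : pred I) (F : I -> 'M[C]_d) :
  schatten1 (\sum_(i <- r | Q i) F i) <= \sum_(i <- r | Q i) schatten1 (F i).
Proof.
elim/big_ind2: _ => [|x u y v hx hy|//]; first by rewrite schatten10.
exact: le_trans (schatten1D _ _) (lerD hx hy).
Qed.

Lemma normc_tr X : normc (\tr X) <= schatten1 X.
Proof. by have := normc_tr_contraction X opbounded1; rewrite mul1mx. Qed.

Lemma tr_col_row a b W : \tr (W *m (b *m a^t* )) = (a^t* *m W *m b) 0 0.
Proof. by rewrite mulmxA mxtrace_mulC mulmxA /mxtrace big_ord1. Qed.

Lemma opbounded_col_row a b : opbounded (a *m b^t* ) (euclid_norm a * euclid_norm b).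
Proof.
move=> u v; rewrite mulmxA -mulmxA mxE big_ord1 Normc.normcM.
apply: le_trans (ler_pM (normc_ge0 _) (normc_ge0 _)
  (normc_dot_le u a) (normc_dot_le b v)) _.
by rewrite le_eqVlt; apply/orP; left; apply/eqP; ring.
Qed.

Lemma normc_quad a b X :
  normc ((a^t* *m X *m b) 0 0) <= euclid_norm a * euclid_norm b * schatten1 X.
Proof.
rewrite -tr_col_row mxtrace_mulC mulrC [euclid_norm a * _]mulrC mulrC.
exact/normc_tr_le/opbounded_col_row.
Qed.

Lemma schatten1_col_row a b : schatten1 (a *m b^t* ) <= euclid_norm a * euclid_norm b.
Proof.
apply: schatten1_le => W W1; rewrite tr_col_row (le_trans (W1 _ _))//.
by rewrite mul1r mulrC.
Qed.

Lemma euclid_delta (i : 'I_d) : euclid_norm (delta_mx i 0 : 'cV[C]_d) = 1.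
Proof.
rewrite /euclid_norm (bigD1 i)//= mxE !eqxx Normc.normc1 expr1n big1.
  by rewrite addr0 sqrtr1.
by move=> j /negPf ji; rewrite mxE ji Normc.normc0 expr0n.
Qed.

Lemma delta_adj (i : 'I_d) : (delta_mx i 0 : 'cV[C]_d)^t* = delta_mx 0 i.
Proof. by rewrite trmx_delta map_delta_mx. Qed.

Lemma normc_entry X i j : normc (X i j) <= schatten1 X.
Proof.
have := normc_quad (delta_mx i 0) (delta_mx j 0) X.
by rewrite !euclid_delta !mul1r delta_adj -rowE -colE !mxE.
Qed.

Lemma schatten1_entries X : schatten1 X <= \sum_i \sum_j normc (X i j).
Proof.
rewrite {1}[X]matrix_sum_delta (le_trans (schatten1_sum _ _ _))//.
apply: ler_sum => i _; rewrite (le_trans (schatten1_sum _ _ _))//.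
apply: ler_sum => j _; rewrite schatten1Z ler_piMr ?normc_ge0//.
have := schatten1_col_row (delta_mx i 0) (delta_mx j 0).
by rewrite !euclid_delta !mul1r delta_adj mul_delta_mx.
Qed.

Lemma schatten1_eq0 X : schatten1 X = 0 -> X = 0.
Proof.
move=> X0; apply/matrixP => i j; rewrite mxE; apply: Normc.eq0_normc.
by apply/le_anti; rewrite normc_ge0 -X0 normc_entry.
Qed.

Lemma schatten1_mull A c X : opbounded A c -> schatten1 (A *m X) <= c * schatten1 X.
Proof.
move=> Ac; apply: schatten1_le => W W1; rewrite mulmxA.
by apply: normc_tr_le; rewrite -[c]mul1r; exact: opboundedM.
Qed.

Lemma mxtrace_adj A : \tr (A^t* ) = Num.conj (\tr A).
Proof. by rewrite /mxtrace rmorph_sum; apply: eq_bigr => i _; rewrite !mxE. Qed.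

Lemma schatten1_adj X : schatten1 (X^t* ) = schatten1 X.
Proof.
have le Y : schatten1 (Y^t* ) <= schatten1 Y.
  apply: schatten1_le => W /opbounded_adj W1.
  rewrite -normc_conj -mxtrace_adj adjmxM trmxCK mxtrace_mulC.
  exact: normc_tr_contraction.
apply/le_anti/andP; split; first exact: le.
by have := le (X^t* ); rewrite trmxCK.
Qed.

Lemma schatten1_mulr A c X : opbounded A c -> schatten1 (X *m A) <= c * schatten1 X.
Proof.
move=> Ac; rewrite -schatten1_adj adjmxM -[schatten1 X]schatten1_adj.
exact/schatten1_mull/opbounded_adj.
Qed.

(** * Positive matrices *)

Lemma mul_diag_unitary_sum (U : 'M[C]_d) (D : 'rV[C]_d) :
  U^t* *m diag_mx D *m U =
  \sum_i D 0 i *: (col i (U^t* ) *m (col i (U^t* ))^t* ).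
Proof.
apply/matrixP => i j; rewrite summxE mxE; apply: eq_bigr => l _.
rewrite mul_mx_diag !mxE big_ord1 !mxE conjCK -mulrA mulrCA.
by rewrite mulrC mulrAC mulrC mulrA.
Qed.

Lemma opbounded_unitary (U : 'M[C]_d) : U^t* *m U = 1%:M -> opbounded U 1.
Proof. by move=> U1; apply: opboundedP => // v; rewrite euclid_isometry// mul1r. Qed.

Lemma opbounded_diag (D : 'rV[C]_d) : (forall i, normc (D 0 i) <= 1) ->
  opbounded (diag_mx D) 1.
Proof.
move=> D1; apply: opboundedP => // v; rewrite mul1r ler_wsqrtr//.
apply: ler_sum => i _; rewrite mul_diag_mx mxE Normc.normcM.
by rewrite ler_pXn2r ?nnegrE ?mulr_ge0 ?normc_ge0// ler_piMl ?normc_ge0.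
Qed.

Let eigR X i := complex.Re (spectral_diag X 0 i).

Lemma herm_eigR X i : X \is hermsymmx -> spectral_diag X 0 i = (eigR X i)%:C.
Proof.
by move=> Xh; rewrite RRe_real//; exact/(mxOverP (hermitian_spectral_diag_real Xh)).
Qed.

(** The eigenprojections bound the trace norm from above; the matrix with the
    same eigenvectors and the signs of the eigenvalues attains the bound. *)
Lemma schatten1_herm X : X \is hermsymmx -> schatten1 X = \sum_i `|eigR X i|.
Proof.
move=> Xh; set U := spectralmx X.
have XE : X = U^t* *m diag_mx (spectral_diag X) *m U by exact: herm_spectral.
have U1 := spectral_unitary X; have U2 := spectral_unitaryV X.
apply/le_anti/andP; split.
  rewrite {1}XE mul_diag_unitary_sum (le_trans (schatten1_sum _ _ _))//; apply: ler_sum => i _.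
  rewrite schatten1Z herm_eigR// normc_real ler_piMr//.
  rewrite (le_trans (schatten1_col_row _ _))//.
  by rewrite euclid_col_unitary// mulr1.
have W1 : opbounded (U^t* *m diag_mx (\row_i (Num.sg (eigR X i))%:C) *m U) 1.
  rewrite -[1]mulr1; apply: opboundedM => //; last exact: opbounded_unitary.
  rewrite -[1]mulr1; apply: opboundedM => //; last first.
    by apply: opbounded_diag => i; rewrite mxE normc_real normr_sg; case: eqP.
  by apply: opbounded_unitary; rewrite trmxCK.
apply: le_trans (normc_tr_contraction X W1); apply: le_trans (Re_le_normc _).
rewrite [V in \tr (_ *m V)]XE -!mulmxA (mulmxA U) U1 mul1mx mxtrace_mulC -!mulmxA U1 mulmx1.
rewrite mulmx_diag mxtrace_diag.
rewrite (raddf_sum (@complex.Re R)) ler_sum// => i _.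
by rewrite !mxE herm_eigR// -rmorphM /= -normrEsg.
Qed.

Lemma psd_eigR X i : psdmx X -> 0 <= eigR X i.
Proof.
move=> [Xh Xpos]; set U := spectralmx X.
have XE : X = U^t* *m diag_mx (spectral_diag X) *m U by exact: herm_spectral.
have U1 := spectral_unitary X; have U2 := spectral_unitaryV X.
rewrite -ler0c -herm_eigR//.
have := Xpos (col i (U^t* )); congr (_ <= _).
have -> : col i (U^t* ) = U^t* *m delta_mx i 0 by rewrite colE.
rewrite adjmxM trmxCK delta_adj.
have assoc (r : 'rV[C]_d) (V : 'M[C]_d) (v : 'cV[C]_d) :
    r *m U *m X *m (V *m v) = r *m (U *m X *m V) *m v by rewrite !mulmxA.
rewrite assoc.
have -> : U *m X *m (U^t* ) = diag_mx (spectral_diag X).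
  transitivity (U *m (U^t* *m diag_mx (spectral_diag X) *m U) *m (U^t* )).
    by rewrite -XE.
  by rewrite !mulmxA U1 mul1mx -mulmxA U1 mulmx1.
by rewrite -rowE -colE !mxE eqxx mulr1n.
Qed.

Lemma tr_herm X : X \is hermsymmx -> \tr X = (\sum_i eigR X i)%:C.
Proof.
move=> Xh; rewrite [X in LHS](herm_spectral Xh).
rewrite mxtrace_mulC mulmxA spectral_unitary mul1mx mxtrace_diag rmorph_sum.
by apply: eq_bigr => i _; rewrite herm_eigR.
Qed.

Lemma schatten1_psd X : psdmx X -> \tr X = (schatten1 X)%:C.
Proof.
move=> Xp; have [Xh _] := Xp; rewrite tr_herm// schatten1_herm//.
by congr (_%:C); apply: eq_bigr => i _; rewrite ger0_norm ?psd_eigR.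
Qed.

Lemma psd0 : psdmx (0 : 'M[C]_d).
Proof.
split; first by apply/is_hermitianmxP; rewrite trmx0 map_mx0 scaler0.
by move=> v; rewrite mulmx0 mul0mx mxE.
Qed.

Lemma hermP X : reflect (X^t* = X) (X \is hermsymmx).
Proof.
by apply: (iffP (is_hermitianmxP _ _ _)); rewrite expr0 scale1r => /esym.
Qed.

Lemma psdD X Y : psdmx X -> psdmx Y -> psdmx (X + Y).
Proof.
move=> [/hermP Xh X0] [/hermP Yh Y0]; split.
  by apply/hermP; rewrite linearD /= map_mxD Xh Yh.
by move=> v; rewrite mulmxDr mulmxDl mxE addr_ge0.
Qed.

Lemma psdZ (t : R) X : 0 <= t -> psdmx X -> psdmx (t%:C *: X).
Proof.
move=> t0 [/hermP Xh X0]; split.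
  apply/hermP; rewrite linearZ /= map_mxZ Xh; congr (_ *: _).
  exact: conjc_real.
by move=> v; rewrite -scalemxAr -scalemxAl mxE mulr_ge0// ler0c.
Qed.

Lemma psd_sum (I : Type) (r : seq I) (Q : pred I) (F : I -> 'M[C]_d) :
  (forall i, Q i -> psdmx (F i)) -> psdmx (\sum_(i <- r | Q i) F i).
Proof.
move=> h; elim/big_rec: _ => [|i Y Qi Yp]; first exact: psd0.
exact: psdD (h _ Qi) Yp.
Qed.

Lemma psd_conj A X : psdmx X -> psdmx (A *m X *m A^t* ).
Proof.
move=> [/hermP Xh X0]; split.
  by apply/hermP; rewrite !adjmxM trmxCK Xh mulmxA.
by move=> v; have := X0 (A^t* *m v); rewrite adjmxM trmxCK !mulmxA.
Qed.

Lemma psd_col_row v : psdmx (v *m v^t* ).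
Proof.
split; first by apply/hermP; rewrite adjmxM trmxCK.
move=> u; rewrite mulmxA -mulmxA mxE big_ord1.
have -> : (v^t* *m u) 0 0 = Num.conj ((u^t* *m v) 0 0).
  have -> : v^t* *m u = (u^t* *m v)^t* by rewrite adjmxM trmxCK.
  by rewrite [LHS]mxE [in LHS]mxE.
exact: mul_conjC_ge0.
Qed.

(** The positive and negative parts of the spectral decomposition. *)
Lemma herm_jordan X : X \is hermsymmx -> exists Y Z,
  [/\ psdmx Y, psdmx Z, X = Y - Z & schatten1 X = schatten1 Y + schatten1 Z].
Proof.
move=> Xh; set U := spectralmx X; pose V i := col i (U^t* ) *m (col i (U^t* ))^t*.
have Vp i : psdmx (V i) by exact: psd_col_row.
pose Y := \sum_i (Num.max (eigR X i) 0)%:C *: V i.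
pose Z := \sum_i (Num.max (- eigR X i) 0)%:C *: V i.
have Yp : psdmx Y.
  by apply: psd_sum => i _; apply: (psdZ _ (Vp i)); rewrite le_max lexx orbT.
have Zp : psdmx Z.
  by apply: psd_sum => i _; apply: (psdZ _ (Vp i)); rewrite le_max lexx orbT.
have XE : X = Y - Z.
  rewrite {1}(herm_spectral Xh) mul_diag_unitary_sum /Y /Z -sumrB; apply: eq_bigr => i _.
  rewrite -scalerBl herm_eigR// -rmorphB; congr (_%:C *: _).
  by rewrite maxBN.
exists Y, Z; split => //; apply/le_anti/andP; split; first by rewrite {1}XE schatten1B.
have trV i : \tr (V i) = 1.
  rewrite /V mxtrace_mulC /mxtrace big_ord1 euclid_sqr euclid_col_unitary.
    by rewrite expr1n.
  exact: spectral_unitary.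
have trY := schatten1_psd Yp; have trZ := schatten1_psd Zp.
apply: (@le_trans _ _ (complex.Re (\tr Y + \tr Z))); first by rewrite trY trZ -rmorphD /=.
have -> : \tr Y + \tr Z = (\sum_i `|eigR X i|)%:C.
  rewrite rmorph_sum /Y /Z !(raddf_sum (@mxtrace _ _)) -big_split.
  by apply: eq_bigr => i _; rewrite /= !mxtraceZ trV !mulr1 -rmorphD maxDN.
by rewrite schatten1_herm.
Qed.
End schatten_norm.

(** * Operator norms and the Lindblad generator *)

Section operator_norms.
Context {R : realType} {d : nat}.
Local Notation C := R[i].
Implicit Types (a b v : 'cV[C]_d) (W A X Y : 'M[C]_d) (c : R) (z : C).

Lemma opbounded_schatten1 A : opbounded A (schatten1 A).
Proof. by move=> a b; rewrite mulrC; exact: normc_quad. Qed.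

Lemma opnorm_euclid A v : euclid_norm (A *m v) <= opnorm A * euclid_norm v.
Proof.
have [/euclid_eq0 ->|v0] := eqVneq (euclid_norm v) 0.
  by rewrite mulmx0 euclid0 mulr0.
have vgt0 : 0 < euclid_norm v by rewrite lt_def v0 euclid_ge0.
rewrite -ler_pdivrMr//; apply: ub_le_sup.
  exists (schatten1 A) => _ [u /= u1 <-].
  rewrite (le_trans (opbounded_euclid _ (opbounded_schatten1 A)))//.
  by rewrite ler_piMr// schatten1_ge0.
have nV : normc ((euclid_norm v)^-1)%:C = (euclid_norm v)^-1.
  by rewrite normc_real ger0_norm// invr_ge0 euclid_ge0.
exists (((euclid_norm v)^-1)%:C *: v) => /=.
  by rewrite euclidZ nV mulVf.
by rewrite -scalemxAr euclidZ nV mulrC.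
Qed.

Lemma opnorm_ge0 A : 0 <= opnorm A.
Proof.
apply: ub_le_sup.
  exists (schatten1 A) => _ [u /= u1 <-].
  rewrite (le_trans (opbounded_euclid _ (opbounded_schatten1 A)))//.
  by rewrite ler_piMr// schatten1_ge0.
by exists 0; rewrite /= ?mulmx0 euclid0.
Qed.

Lemma opbounded_opnorm A : opbounded A (opnorm A).
Proof. by apply: opboundedP => [|v]; [exact: opnorm_ge0|exact: opnorm_euclid]. Qed.

Lemma superop_norm1_ub (B : 'M[C]_d -> 'M[C]_d) c :
  (forall (t : R) X, B (t%:C *: X) = t%:C *: B X) ->
  (forall X, schatten1 (B X) <= c * schatten1 X) ->
  forall X, schatten1 (B X) <= superop_norm1 B * schatten1 X.
Proof.
move=> BZ Bc X; have [X0|X0] := eqVneq (schatten1 X) 0.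
  by rewrite (le_trans (Bc X))// X0 !mulr0.
have Xgt0 : 0 < schatten1 X by rewrite lt_def X0 schatten1_ge0.
rewrite -ler_pdivrMr//; apply: ub_le_sup.
  exists `|c| => _ [Y /= Y1 <-]; rewrite (le_trans (Bc Y))//.
  rewrite (le_trans (ler_wpM2r _ (ler_norm c))) ?schatten1_ge0//.
  by rewrite ler_piMr.
exists (((schatten1 X)^-1)%:C *: X) => /=.
  by rewrite schatten1Zr ger0_norm ?invr_ge0 ?schatten1_ge0// mulVf.
by rewrite BZ schatten1Zr ger0_norm ?invr_ge0 ?schatten1_ge0// mulrC.
Qed.

Lemma superop_norm1_le (B : 'M[C]_d -> 'M[C]_d) c : 0 <= c ->
  (forall X, schatten1 (B X) <= c * schatten1 X) -> superop_norm1 B <= c.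
Proof.
move=> c0 Bc; apply: ge_sup.
  by exists (schatten1 (B 0)); exists 0; rewrite //= schatten10.
move=> _ [X /= X1 <-]; rewrite (le_trans (Bc X))//; exact: ler_piMr.
Qed.

Lemma superop_norm1_ge0 (B : 'M[C]_d -> 'M[C]_d) c :
  (forall X, schatten1 (B X) <= c * schatten1 X) -> 0 <= superop_norm1 B.
Proof.
move=> Bc; apply: le_trans (schatten1_ge0 (B 0)) _; apply: ub_le_sup.
  exists `|c| => _ [Y /= Y1 <-]; rewrite (le_trans (Bc Y))//.
  rewrite (le_trans (ler_wpM2r _ (ler_norm c))) ?schatten1_ge0//.
  by rewrite ler_piMr.
by exists 0; rewrite //= schatten10.
Qed.

Lemma sum_cauchy_schwarz (k : nat) (x y : 'I_k -> R) :
  \sum_i x i * y i <= Num.sqrt (\sum_i x i ^+ 2) * Num.sqrt (\sum_i y i ^+ 2).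
Proof.
have E (u : 'I_k -> R) : euclid_norm (\col_i (u i)%:C) = Num.sqrt (\sum_i u i ^+ 2).
  congr Num.sqrt; apply: eq_bigr => i _.
  by rewrite mxE normc_real -normrX ger0_norm ?sqr_ge0.
rewrite -!E; apply: le_trans (normc_dot_le _ _); apply: le_trans (Re_le_normc _).
rewrite mxE (raddf_sum (@complex.Re R)) ler_sum// => i _.
rewrite !mxE (_ : Num.conj _ = (x i)%:C); last exact: conjc_real.
by rewrite -rmorphM.
Qed.

End operator_norms.

Section jumps.
Context {R : realType} {d k : nat}.
Local Notation C := R[i].
Variables (H : 'M[C]_d) (L : 'I_k -> 'M[C]_d).
Implicit Types (X Y W : 'M[C]_d).
Local Notation J := (Jeff H L).
Local Notation LL := (jumps L).

Lemma jumps_is_linear : linear LL.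
Proof.
move=> z X Y; rewrite /jumps scaler_sumr -big_split; apply: eq_bigr => j _ /=.
by rewrite mulmxDr mulmxDl -scalemxAr -scalemxAl.
Qed.

Lemma jumps0 : LL 0 = 0.
Proof. by rewrite /jumps big1// => j _; rewrite mulmx0 mul0mx. Qed.

Lemma sum_euclid_jumps c (v : 'cV[C]_d) : opbounded (\sum_j (L j)^t* *m L j) c ->
  \sum_j euclid_norm (L j *m v) ^+ 2 <= c * euclid_norm v ^+ 2.
Proof.
move=> Sc; have := Sc v v; apply: le_trans; apply: le_trans (Re_le_normc _).
rewrite mulmx_sumr mulmx_suml summxE (raddf_sum (@complex.Re R)) ler_sum// => j _.
by rewrite mulmxA -mulmxA -adjmxM euclid_sqr.
Qed.

(** By duality the bound is about the form sum_k L_k^t* W L_k, and the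
    Cauchy-Schwarz inequality over k reduces it to W = 1.  The argument
    loses no factor when X is not Hermitian. *)
Lemma jumps_bound c X : 0 <= c -> opbounded (\sum_j (L j)^t* *m L j) c ->
  schatten1 (LL X) <= c * schatten1 X.
Proof.
move=> c0 Sc; apply: schatten1_le => W W1.
have -> : \tr (W *m LL X) = \tr ((\sum_j (L j)^t* *m W *m L j) *m X).
  rewrite mulmx_sumr mulmx_suml !(raddf_sum (@mxtrace _ _)); apply: eq_bigr => j _.
  by rewrite /= mulmxA mxtrace_mulC !mulmxA.
apply: normc_tr_le => a b; rewrite mulmx_sumr mulmx_suml summxE.
rewrite (le_trans (normc_sum _ _ _))//.
apply: (@le_trans _ _ (\sum_j euclid_norm (L j *m a) * euclid_norm (L j *m b))).
  apply: ler_sum => j _; rewrite !mulmxA -adjmxM -mulmxA.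
  by have := W1 (L j *m a) (L j *m b); rewrite mul1r.
rewrite (le_trans (sum_cauchy_schwarz _ _))//.
have le v : Num.sqrt (\sum_j euclid_norm (L j *m v) ^+ 2) <=
    Num.sqrt c * euclid_norm v.
  rewrite -[euclid_norm v]ger0_norm ?euclid_ge0// -sqrtr_sqr -sqrtrM//.
  exact/ler_wsqrtr/sum_euclid_jumps.
rewrite (le_trans (ler_pM _ _ (le a) (le b))) ?sqrtr_ge0//.
by rewrite mulrACA -expr2 sqr_sqrtr.
Qed.

Lemma jumps_psd X : psdmx X -> psdmx (LL X).
Proof. by move=> Xp; apply: psd_sum => j _; exact: psd_conj. Qed.

Hypothesis H_herm : H \is hermsymmx.

Local Notation S := (\sum_j (L j)^t* *m L j).

Lemma JeffE : J = - 'i *: H - 2^-1 *: S.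
Proof.
have i0 : 'i != 0 :> C by exact: neq0Ci.
rewrite /Jeff /Heff scalerDr scalerA mulNr invfM mulrCA mulfV// mulr1.
by congr (_ + _); exact: scaleNr.
Qed.

Lemma Jeff_adjE : J^t* = 'i *: H - 2^-1 *: S.
Proof.
have /hermP Hh := H_herm.
have Sh : S^t* = S.
  rewrite raddf_sum (raddf_sum (@map_mx _ _ Num.conj _ _)); apply: eq_bigr => j _.
  by rewrite /= adjmxM trmxCK.
rewrite JeffE linearB /= map_mxB !linearZ /= !map_mxZ Hh Sh rmorphN /= conjCi.
rewrite (_ : Num.conj 2^-1 = 2^-1); last by rewrite fmorphV /= rmorph_nat.
by rewrite opprK scalerN.
Qed.

(** Trace preservation in disguise: the non-Hermitian part of the effective
    Hamiltonian compensates the jumps exactly. *)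
Lemma Jeff_adj : J + J^t* = - S.
Proof.
rewrite Jeff_adjE JeffE addrACA scaleNr addNr add0r -opprD -scalerDl.
by rewrite -div1r -splitr scale1r.
Qed.

Lemma opbounded_sum_jumps : opbounded (\sum_j (L j)^t* *m L j) (2 * opnorm J).
Proof.
rewrite -[\sum_j _]opprK -Jeff_adj; apply: opboundedN.
rewrite mulr_natl mulr2n; apply: opboundedD; first exact: opbounded_opnorm.
exact/opbounded_adj/opbounded_opnorm.
Qed.

Local Notation j := (opnorm J).
Local Notation l := (superop_norm1 LL).

Lemma jumps_opnorm X : schatten1 (LL X) <= 2 * j * schatten1 X.
Proof.
by apply: jumps_bound; [rewrite mulr_ge0 ?opnorm_ge0|exact: opbounded_sum_jumps].
Qed.

Lemma jumps_norm1 X : schatten1 (LL X) <= l * schatten1 X.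
Proof.
apply: (superop_norm1_ub _ jumps_opnorm) => t Y.
by have := jumps_is_linear t%:C Y 0; rewrite jumps0 !addr0.
Qed.

Lemma jumps_norm1_ge0 : 0 <= l.
Proof. exact: superop_norm1_ge0 jumps_opnorm. Qed.

(** This makes dt times the norm of the jump part at most 2, although only J is
    assumed to be small. *)
Lemma jumps_norm1_le : l <= 2 * j.
Proof.
by apply: superop_norm1_le jumps_opnorm; rewrite mulr_ge0 ?opnorm_ge0.
Qed.

Lemma lindbladE X : lindblad H L X = J *m X + X *m J^t* + LL X.
Proof.
rewrite Jeff_adjE JeffE /lindblad big_split /= [in LHS]addrCA [RHS]addrC.
congr (_ + _); rewrite mulmxBl mulmxBr -!scalemxAl -!scalemxAr.
rewrite addrACA scalerBr [- 'i *: (X *m H)]scaleNr opprK; congr (_ + _).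
by rewrite -opprD -scalerDr mulmx_suml mulmx_sumr -big_split scaler_sumr sumrN.
Qed.
End jumps.

(** * Words in the generator *)

Lemma sum_bin_hockey_stick K n : (\sum_(c < n) 'C(c, K))%N = 'C(n, K.+1).
Proof. by elim: n => [|n IH]; rewrite ?big_ord0// big_ord_recr IH /= binS. Qed.

(** Both sides count the subsets of n points with K + m + 1 elements, by the
    position c of the element of rank K + 1. *)
Lemma bin_convolution K m n :
  (\sum_(c < n) 'C(c, K) * 'C(n - c.+1, m))%N = 'C(n, (K + m).+1).
Proof.
elim: n m => [|n IH] m; first by rewrite big_ord0.
case: m => [|m].
  by under eq_bigr do rewrite bin0 muln1; rewrite sum_bin_hockey_stick addn0.
rewrite big_ord_recr /= subnn muln0 addn0 binS -(IH m.+1) addnS -(IH m).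
rewrite -big_split; apply: eq_bigr => c _ /=.
by rewrite subSS -mulnDr -binS -subSn.
Qed.

Lemma sum_bin_tail K c :
  (\sum_(i < c.+1 | (K <= i)%N) 'C(c, i) <= 2 ^ (c - K) * 'C(c, K))%N.
Proof.
elim: c K => [|c IH] [|K].
- by rewrite big_mkcond big_ord1 /= bin0.
- by rewrite big_mkcond big_ord1.
- rewrite subn0 bin0 muln1 (expnDn 1 1).
  by apply: eq_leq; apply: eq_bigr => i _; rewrite !exp1n !muln1.
rewrite big_mkcond big_ord_recl /= add0n.
under eq_bigr => i _ do rewrite /bump leq0n add1n ltnS binS.
rewrite -big_mkcond big_split /=.
rewrite [X in (_ + X <= _)%N](_ : _ = \sum_(i < c.+1 | (K <= i)%N) 'C(c, i))%N//.
rewrite [X in (X + _ <= _)%N](_ : _ = \sum_(i < c.+1 | (K.+1 <= i)%N) 'C(c, i))%N.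
  have [cK|Kc] := leqP c K.
    rewrite [X in (X + _ <= _)%N]big1 ?add0n; last first.
      by move=> i Ki; rewrite bin_small// (leq_ltn_trans cK).
    apply: leq_trans (IH K) _; rewrite subSS binS mulnDr leq_addl//.
  rewrite subSS binS mulnDr; apply: leq_add; last exact: IH.
  by rewrite (leq_trans (IH K.+1))// leq_mul2r leq_pexp2l ?orbT// leq_sub2l.
rewrite [in RHS]big_mkcond [in RHS]big_ord_recl /= add0n.
rewrite big_mkcond big_ord_recr /= bin_small// if_same addn0.
by apply: eq_bigr => i _; rewrite /bump leq0n add1n ltnS.
Qed.

Section words.
Context {R : realType} {d : nat}.
Local Notation C := R[i].
Implicit Types (X Y W : 'M[C]_d) (P : rel nat).
Variables (J : 'M[C]_d) (LL : 'M[C]_d -> 'M[C]_d).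
Hypothesis LL_linear : linear LL.

Definition sandwich a b X := J ^+ a *m X *m (J ^+ b)^t*.

(** The letters J . and . J^t* commute, so a run of c letters without jumps is a
    binomial sum.  The predicate P says which pairs of exponents are kept: all
    of them for the exact semigroup, those below the truncation order for the
    scheme. *)
Definition block P c X :=
  \sum_(i < c.+1 | P i (c - i)%N) 'C(c, i)%:R *: sandwich i (c - i) X.

(** The sum of all words of n letters with exactly m jumps, split according to
    the length c of the run that follows the last jump. *)
Fixpoint jumped P m n X :=
  match m with
  | 0 => block P n X
  | m'.+1 => \sum_(c < n) block P c (LL (jumped P m' (n - c.+1)%N X))
  end.

Definition full : rel nat := fun _ _ => true.

Lemma LL0 : LL 0 = 0.
Proof. by have := LL_linear (-1) 0 0; rewrite scaler0 addr0 scaleN1r addNr. Qed.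

Lemma LLD X Y : LL (X + Y) = LL X + LL Y.
Proof. by have := LL_linear 1 X Y; rewrite !scale1r. Qed.

Lemma LLZ z X : LL (z *: X) = z *: LL X.
Proof. by have := LL_linear z X 0; rewrite LL0 !addr0. Qed.

Lemma LLB X Y : LL (X - Y) = LL X - LL Y.
Proof. by rewrite -[- Y]scaleN1r LLD LLZ scaleN1r. Qed.

Lemma LL_sum (I : Type) (r : seq I) (Q : pred I) (F : I -> 'M[C]_d) :
  LL (\sum_(i <- r | Q i) F i) = \sum_(i <- r | Q i) LL (F i).
Proof. exact: (big_morph LL LLD LL0). Qed.

Lemma sandwich_sum a b (I : Type) (r : seq I) (Q : pred I) (F : I -> 'M[C]_d) :
  sandwich a b (\sum_(i <- r | Q i) F i) = \sum_(i <- r | Q i) sandwich a b (F i).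
Proof. by rewrite /sandwich mulmx_sumr mulmx_suml. Qed.

Lemma sandwichZ a b z X : sandwich a b (z *: X) = z *: sandwich a b X.
Proof. by rewrite /sandwich -scalemxAr -scalemxAl. Qed.

Lemma sandwich00 X : sandwich 0 0 X = X.
Proof. by rewrite /sandwich !expr0 trmx1 map_mx1 mul1mx mulmx1. Qed.

Lemma block0 X : block full 0 X = X.
Proof. by rewrite /block big_mkcond big_ord1 /= bin0 scale1r sandwich00. Qed.

Lemma blockZ P c z X : block P c (z *: X) = z *: block P c X.
Proof.
rewrite /block scaler_sumr; apply: eq_bigr => i _.
by rewrite sandwichZ !scalerA mulrC.
Qed.

Lemma blockB P c X Y : block P c (X - Y) = block P c X - block P c Y.
Proof.
rewrite /block -sumrB; apply: eq_bigr => i _.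
by rewrite /sandwich mulmxBr mulmxBl scalerBr.
Qed.

Lemma block_zero P c : block P c 0 = 0.
Proof. by have := blockZ P c 0 0; rewrite !scale0r. Qed.

Lemma block_fullS c X :
  block full c.+1 X = J *m block full c X + block full c X *m J^t*.
Proof.
have Jl a b : J *m sandwich a b X = sandwich a.+1 b X.
  by rewrite /sandwich exprS -!mulmxE !mulmxA.
have Jr a b : sandwich a b X *m J^t* = sandwich a b.+1 X.
  by rewrite /sandwich exprS -!mulmxE adjmxM !mulmxA.
rewrite /block mulmx_sumr mulmx_suml.
under [X in _ = X + _]eq_bigr => i _ do rewrite -scalemxAr Jl.
under [X in _ = _ + X]eq_bigr => i _ do rewrite -scalemxAl Jr.
rewrite big_ord_recl /= subn0 bin0.
under eq_bigr => i _ do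
  rewrite /bump leq0n add1n subSS binS natrD scalerDl.
rewrite big_split /= addrA addrC; congr (_ + _).
transitivity (\sum_(i < c.+2) 'C(c, i)%:R *: sandwich i (c.+1 - i) X).
  by rewrite [RHS]big_ord_recl /= subn0 bin0.
rewrite big_ord_recr /= bin_small// scale0r addr0.
by apply: eq_bigr => i _; rewrite subSn// -ltnS.
Qed.

Lemma jumped_small P m n X : (n < m)%N -> jumped P m n X = 0.
Proof.
elim: m n => [//|m IH] n; rewrite ltnS => nm /=; apply: big1 => c _.
by rewrite IH ?LL0 ?block_zero//; have := ltn_ord c; lia.
Qed.

Lemma jumped_fullS m n X : jumped full m.+1 n.+1 X =
  LL (jumped full m n X) +
  (J *m jumped full m.+1 n X + jumped full m.+1 n X *m J^t* ).
Proof.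
rewrite /= big_ord_recl /= block0 subSS subn0; congr (_ + _).
rewrite mulmx_sumr mulmx_suml -big_split; apply: eq_bigr => c _ /=.
by rewrite /bump leq0n add1n block_fullS subSS.
Qed.

(** Expanding the n-th power of the generator, by the number m of jumps.  Any
    bound N >= n will do, because a word has at least as many letters as jumps. *)
Lemma iter_jumped (G : 'M[C]_d -> 'M[C]_d) N n X :
  (forall Y, G Y = J *m Y + Y *m J^t* + LL Y) -> (n <= N)%N ->
  iter n G X = \sum_(m < N.+1) jumped full m n X.
Proof.
move=> GE; elim: n => [|n IH] nN.
  rewrite big_ord_recl big1 ?addr0/= ?block0// => m _.
  by rewrite /= big_ord0.
rewrite iterS IH ?(ltnW nN)// GE mulmx_sumr mulmx_suml -big_split /=.
rewrite LL_sum [X in _ + X]big_ord_recr /= jumped_small// LL0 addr0.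
rewrite [RHS]big_ord_recl /= block_fullS [X in X + _]big_ord_recl /= -!addrA.
congr (_ + _); congr (_ + _); rewrite addrC -big_split; apply: eq_bigr => m _.
exact: esym (jumped_fullS m n X).
Qed.

Variables (j l : R).
Hypotheses (j0 : 0 <= j) (Jj : opbounded J j) (l0 : 0 <= l).
Hypothesis LLl : forall X, schatten1 (LL X) <= l * schatten1 X.

Lemma opboundedX a : opbounded (J ^+ a) (j ^+ a).
Proof.
elim: a => [|a IH]; first by rewrite !expr0; exact: opbounded1.
by rewrite !exprS; apply: opboundedM.
Qed.

Lemma sandwich_bound a b X :
  schatten1 (sandwich a b X) <= j ^+ (a + b) * schatten1 X.
Proof.
apply: le_trans (schatten1_mulr _ (opbounded_adj (opboundedX b))) _.
rewrite addnC exprD -mulrA; apply: ler_wpM2l; first by rewrite exprn_ge0.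
exact: schatten1_mull (opboundedX a).
Qed.

Lemma block_sum_bound (Q : pred nat) c X :
  schatten1 (\sum_(i < c.+1 | Q i) 'C(c, i)%:R *: sandwich i (c - i) X) <=
  (\sum_(i < c.+1 | Q i) 'C(c, i))%N%:R * j ^+ c * schatten1 X.
Proof.
rewrite (le_trans (schatten1_sum _ _ _))// -mulrA natr_sum mulr_suml.
apply: ler_sum => i _; rewrite schatten1Z.
rewrite (_ : normc _ = 'C(c, i)%:R); last first.
  by rewrite -(rmorph_nat (real_complex R)) normc_real ger0_norm.
rewrite ler_wpM2l// (le_trans (sandwich_bound _ _ _))// subnKC//.
by rewrite -ltnS.
Qed.

Lemma block_bound P c X :
  schatten1 (block P c X) <= (2 ^ c)%N%:R * j ^+ c * schatten1 X.
Proof.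
rewrite (le_trans (block_sum_bound (fun i => P i (c - i)%N) _ _))//.
rewrite ler_wpM2r ?schatten1_ge0// ler_wpM2r ?exprn_ge0// ler_nat.
have := sum_bin_tail 0 c; rewrite subn0 bin0 muln1; apply: leq_trans.
by rewrite [leqLHS]big_mkcond; apply: leq_sum => i _; case: ifP.
Qed.

Definition below K : rel nat := fun a b => (a < K)%N && (b < K)%N.

(** A binomial term is lost only when one of its two exponents is at least K. *)
Lemma block_below_bound K c X :
  schatten1 (block full c X - block (below K) c X) <=
  (2 * (2 ^ (c - K) * 'C(c, K)))%N%:R * j ^+ c * schatten1 X.
Proof.
have -> : block full c X - block (below K) c X =
    \sum_(i < c.+1 | ~~ below K i (c - i)%N) 'C(c, i)%:R *: sandwich i (c - i) X.
  apply/eqP; rewrite subr_eq addrC.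
  by rewrite {1}/block (bigID (fun i : 'I_c.+1 => below K i (c - i)%N)).
rewrite (le_trans (block_sum_bound (fun i => ~~ below K i (c - i)%N) _ _))//.
rewrite ler_wpM2r ?schatten1_ge0// ler_wpM2r ?exprn_ge0// ler_nat.
rewrite mul2n -addnn; apply: leq_trans (leq_add (sum_bin_tail K c) (sum_bin_tail K c)).
rewrite [X in (_ <= _ + X)%N](reindex_inj rev_ord_inj)/=.
rewrite big_mkcond [X in (_ <= X + _)%N]big_mkcond [X in (_ <= _ + X)%N]big_mkcond.
rewrite -big_split; apply: leq_sum => i _ /=.
rewrite subSS bin_sub; last by rewrite -ltnS.
rewrite /below negb_and -!leqNgt.
by case: (K <= i)%N; case: (K <= c - i)%N; rewrite /= ?addn0 ?add0n ?leq_addr.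
Qed.

Lemma jumped_bound P m n X :
  schatten1 (jumped P m n X) <=
  ('C(n, m) * 2 ^ (n - m))%N%:R * (j ^+ (n - m) * l ^+ m) * schatten1 X.
Proof.
elim: m n => [|m IH] n.
  by rewrite bin0 mul1n subn0 expr0 mulr1; exact: block_bound.
rewrite /= (le_trans (schatten1_sum _ _ _))//.
apply: (@le_trans _ _ (\sum_(c < n) ('C(c, 0) * 'C(n - c.+1, m))%N%:R *
    ((2 ^ (n - m.+1))%:R * (j ^+ (n - m.+1) * l ^+ m.+1) * schatten1 X))).
  apply: ler_sum => c _; rewrite (le_trans (block_bound _ _ _))//.
  have [lt|ge] := ltnP (n - c.+1) m.
    rewrite jumped_small// LL0 schatten10 mulr0 mulr_ge0// ?mulr_ge0//.
    - by rewrite exprn_ge0.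
    - by rewrite exprn_ge0.
    - exact: schatten1_ge0.
  have cK := ltn_ord c.
  have -> : (n - m.+1 = c + (n - c.+1 - m))%N by lia.
  apply: le_trans (ler_wpM2l _ (le_trans (LLl _) (ler_wpM2l l0 (IH _)))) _.
    by rewrite mulr_ge0 ?exprn_ge0.
  rewrite bin0 mul1n !natrM expnD natrM exprD exprS le_eqVlt; apply/orP; left.
  by apply/eqP; ring.
by rewrite -mulr_suml -natr_sum bin_convolution add0n natrM !mulrA.
Qed.

(** Some block among the m + 1 has lost a term, on one of its two sides: whence
    the factor 2 m + 2.  Such a word of n letters is determined by the places of
    the m jumps and of the first K letters of the overflowing kind in its block,
    which is 'C(n, K + m) choices, and by the side of the remaining letters. *)
Lemma jumped_below_bound K m n X :
  schatten1 (jumped full m n X - jumped (below K) m n X) <=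
  ((2 * m + 2) * (2 ^ (n - m - K) * 'C(n, K + m)))%N%:R *
  (j ^+ (n - m) * l ^+ m) * schatten1 X.
Proof.
elim: m n => [|m IH] n.
  by rewrite muln0 add0n addn0 subn0 expr0 mulr1; exact: block_below_bound.
set B := (2 ^ (n - m.+1 - K))%N; set D := j ^+ (n - m.+1)%N * l ^+ m.+1 * schatten1 X.
have D0 : 0 <= D by rewrite !mulr_ge0 ?exprn_ge0 ?schatten1_ge0.
rewrite /= -sumrB (le_trans (schatten1_sum _ _ _))//.
apply: (@le_trans _ _ (\sum_(c < n) (2 * B * ('C(c, K) * 'C(n - c.+1, m)) +
    (2 * m + 2) * B * ('C(c, 0) * 'C(n - c.+1, K + m)))%N%:R * D)).
  apply: ler_sum => c _.
  set F := jumped full m _ X; set G := jumped (below K) m _ X.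
  have -> : block full c (LL F) - block (below K) c (LL G) =
      (block full c (LL F) - block (below K) c (LL F)) +
      block (below K) c (LL (F - G)) by rewrite LLB blockB addrA subrK.
  rewrite (le_trans (schatten1D _ _))// natrD mulrDl lerD//.
    apply: le_trans (block_below_bound _ _ _) _.
    have [lt|ge] := ltnP (n - c.+1) m.
      rewrite /F jumped_small// LL0 schatten10 mulr0.
      by rewrite mulr_ge0.
    have [ltK|geK] := ltnP c K.
      by rewrite bin_small// !muln0 !mul0r.
    have cK := ltn_ord c.
    apply: le_trans (ler_wpM2l _ (le_trans (LLl _) (ler_wpM2l l0 (jumped_bound _ _ _ _)))) _.
      by rewrite mulr_ge0 ?exprn_ge0.
    rewrite /B /D; have -> : (n - m.+1 - K = (c - K) + (n - c.+1 - m))%N by lia.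
    have -> : (n - m.+1 = c + (n - c.+1 - m))%N by lia.
    rewrite !natrM expnD natrM exprD exprS le_eqVlt; apply/orP; left.
    by apply/eqP; ring.
  apply: le_trans (block_bound _ _ _) _.
  have [lt|ge] := ltnP (n - c.+1) m.
    by rewrite /F /G !jumped_small// subrr LL0 schatten10 mulr0 mulr_ge0.
  have [ltK|geK] := ltnP (n - c.+1) (K + m).
    apply: le_trans (ler_wpM2l _ (le_trans (LLl _) (ler_wpM2l l0 (IH _)))) _.
      by rewrite mulr_ge0 ?exprn_ge0.
    by rewrite bin_small// !muln0 !mul0r !mulr0.
  have cK := ltn_ord c.
  apply: le_trans (ler_wpM2l _ (le_trans (LLl _) (ler_wpM2l l0 (IH _)))) _.
    by rewrite mulr_ge0 ?exprn_ge0.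
  rewrite /B /D; have -> : (n - m.+1 - K = c + (n - c.+1 - m - K))%N by lia.
  have -> : (n - m.+1 = c + (n - c.+1 - m))%N by lia.
  rewrite bin0 mul1n !natrM expnD natrM exprD exprS le_eqVlt; apply/orP; left.
  by apply/eqP; ring.
rewrite -mulr_suml -natr_sum big_split /= -!big_distrr /= !bin_convolution.
rewrite /D add0n mulrA le_eqVlt; apply/orP; left; apply/eqP.
by congr (_%:R * _ * _); rewrite !addnS -!mulnA -mulnDl; congr muln; lia.
Qed.
End words.

(** * Expansion over exponents of the blocks *)

Definition deg (p : nat * nat) := (p.1 + p.2)%N.
Definition degs (s : seq (nat * nat)) := sumn (map deg s).
Definition prod_facts (s : seq (nat * nat)) := (\prod_(p <- s) (p.1`! * p.2`!))%N.
Definition prod_binoms (s : seq (nat * nat)) := (\prod_(p <- s) 'C(deg p, p.1))%N.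
Definition pairs K := [seq (a, b) | a <- index_iota 0 K, b <- index_iota 0 K].

(** A list (a_m, b_m), ..., (a_0, b_0) stands for the word with blocks
    J^a_i . (J^t* )^b_i and a jump between consecutive blocks; the outermost block
    comes first. *)
Fixpoint boxes K m : seq (seq (nat * nat)) :=
  if m is m'.+1 then [seq p :: t | p <- pairs K, t <- boxes K m'] else [:: [::]].

(** Gap number i belongs to the block with i blocks after it in the list. *)
Fixpoint gap_monomial {R : realType} (g : nat -> R) (s : seq (nat * nat)) : R :=
  if s is p :: s' then g (size s') ^+ deg p * gap_monomial g s' else 1.

Lemma sum_pairs (V : nmodType) K (Q : pred (nat * nat)) (F : nat * nat -> V) :
  \sum_(p <- pairs K | Q p) F p =
  \sum_(a < K) \sum_(b < K | Q (nat_of_ord a, nat_of_ord b)) F (nat_of_ord a, nat_of_ord b).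
Proof.
rewrite big_mkcond big_allpairs_dep /= big_mkord; apply: eq_bigr => a _.
by rewrite big_mkord [RHS]big_mkcond.
Qed.

Lemma sum_boxesS (V : nmodType) K m (Q : pred (seq (nat * nat)))
    (F : seq (nat * nat) -> V) :
  \sum_(s <- boxes K m.+1 | Q s) F s =
  \sum_(p <- pairs K) \sum_(s <- boxes K m | Q (p :: s)) F (p :: s).
Proof.
rewrite big_mkcond /= big_allpairs_dep /=; apply: eq_bigr => p _.
by rewrite [RHS]big_mkcond.
Qed.

Lemma mem_pairs K p : (p \in pairs K) = (p.1 < K)%N && (p.2 < K)%N.
Proof.
apply/allpairsP/andP => [[[a b]] /= [+ + ->]|[]].
  by rewrite !mem_index_iota.
by exists p; rewrite !mem_index_iota; case: p a b.
Qed.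

Lemma mem_boxesS K m s : s \in boxes K m.+1 ->
  exists2 p, p \in pairs K & exists2 t, t \in boxes K m & s = p :: t.
Proof.
case/(allpairsP (f := cons)) => -[p t] /= [pK tK ->].
by exists p => //; exists t.
Qed.

Lemma size_boxes K m s : s \in boxes K m -> size s = m.
Proof.
elim: m s => [|m IH] s; first by rewrite inE => /eqP ->.
by move=> /mem_boxesS[p _ [t /IH <- ->]].
Qed.

Lemma degs_boxes K m s : s \in boxes K.+1 m -> (degs s <= 2 * K * m)%N.
Proof.
elim: m s => [|m IH] s; first by rewrite inE => /eqP ->.
move=> /mem_boxesS[p + [t /IH tm ->]].
rewrite mem_pairs /degs /= => /andP[p1 p2].
by rewrite mulnS leq_add// /deg; lia.
Qed.

Section expansion.
Context {R : realType} {d : nat}.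
Local Notation C := R[i].
Implicit Types (X Y W : 'M[C]_d).
Variables (J : 'M[C]_d) (LL : 'M[C]_d -> 'M[C]_d).
Hypothesis LL_linear : linear LL.
Local Notation sandwich := (sandwich J).
Local Notation jumped := (jumped J LL).

Fixpoint word s X :=
  if s is p :: s' then
    sandwich p.1 p.2 (if s' is [::] then X else LL (word s' X))
  else X.

Lemma wordS p s X : (0 < size s)%N ->
  word (p :: s) X = sandwich p.1 p.2 (LL (word s X)).
Proof. by case: s. Qed.

(** The truncated flow of the scheme, for an arbitrary matrix J. *)
Definition flow n t X :=
  let A := \sum_(a < n.+1) (t ^+ a / a`!%:R)%:C *: J ^+ a in A *m X *m A^t*.

Lemma flow_pairs n t X : flow n t X =
  \sum_(p <- pairs n.+1) (t ^+ deg p / (p.1`! * p.2`!)%N%:R)%:C *: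
    sandwich p.1 p.2 X.
Proof.
rewrite sum_pairs /flow /= mulmx_suml mulmx_suml; apply: eq_bigr => a _.
rewrite raddf_sum (raddf_sum (@map_mx _ _ Num.conj _ _)) mulmx_sumr.
apply: eq_bigr => b _.
rewrite /= linearZ /= map_mxZ /= (_ : Num.conj _ = (t ^+ b / b`!%:R)%:C); last first.
  exact: conjc_real.
rewrite -!scalemxAl -scalemxAr scalerA -rmorphM; congr (_%:C *: _).
by rewrite exprD natrM invfM mulrACA.
Qed.

(** The chain of truncated flows and jumps is a polynomial in the gaps whose
    coefficients are words. *)
Lemma chain_boxes n dt (g : nat -> R) i X :
  iteri i (fun j Y => flow n (dt * g j.+1) (LL Y)) (flow n (dt * g 0%N) X) =
  \sum_(s <- boxes n.+1 i.+1)
    (dt ^+ degs s * gap_monomial g s / (prod_facts s)%:R)%:C *: word s X.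
Proof.
elim: i => [|i IH].
  rewrite sum_boxesS /= flow_pairs; apply: eq_bigr => p _.
  rewrite big_seq1 /= /degs /prod_facts /= big_seq1 addn0 mulr1.
  by rewrite exprMn.
rewrite sum_boxesS /= IH flow_pairs; apply: eq_bigr => p _.
rewrite (LL_sum LL_linear) sandwich_sum scaler_sumr big_seq_cond.
rewrite [RHS]big_seq_cond; apply: eq_bigr => s; rewrite andbT => sb.
have sz := size_boxes sb.
rewrite (LLZ LL_linear) sandwichZ scalerA -rmorphM -wordS ?sz//.
congr (_%:C *: _); rewrite exprMn.
rewrite -[degs (p :: s)]/(deg p + degs s)%N exprD.
rewrite /prod_facts big_cons (natrM _ (p.1`! * p.2`!)) invfM.
by ring.
Qed.

Lemma block_pairs K n X : block J (below K) n X =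
  \sum_(p <- pairs K | deg p == n) 'C(deg p, p.1)%:R *: sandwich p.1 p.2 X.
Proof.
rewrite sum_pairs /block.
transitivity (\sum_(a < K) if (a <= n)%N && (n - a < K)%N then
    'C(n, a)%:R *: sandwich a (n - a) X else 0).
  pose F a := if (a <= n)%N && (n - a < K)%N then
    'C(n, a)%:R *: sandwich a (n - a) X else 0.
  transitivity (\sum_(a < K + n.+1 | (a < K)%N && (a < n.+1)%N) F a).
    rewrite (big_ord_widen_cond _ (fun i => below K i (n - i)%N)
      (fun i => 'C(n, i)%:R *: sandwich i (n - i) X) (leq_addl K n.+1)).
    rewrite [LHS]big_mkcond [RHS]big_mkcond; apply: eq_bigr => i _.
    rewrite /F /below ltnS; case: (i < K)%N; case: (i <= n)%N; rewrite ?andbF//=.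
    by rewrite andbT.
  rewrite [RHS](big_ord_widen_cond _ xpredT F (leq_addr n.+1 K)).
  rewrite [LHS]big_mkcond [RHS]big_mkcond; apply: eq_bigr => i _.
  by rewrite /F ltnS /=; case: (i < K)%N; case: (i <= n)%N.
apply: eq_bigr => a _; case: ifP => [/andP[an nK]|h].
  rewrite (big_pred1 (Ordinal nK)) /=; first by rewrite /deg /= subnKC.
  by move=> b; rewrite /= /deg /= -val_eqE /=; lia.
rewrite big1// => b /eqP; rewrite /deg /= => E; case/negP: (negbT h).
by have := ltn_ord b; lia.
Qed.

Lemma jumped_boxes K m n X : jumped (below K) m n X =
  \sum_(s <- boxes K m.+1 | (degs s + m == n)%N) (prod_binoms s)%:R *: word s X.
Proof.
elim: m n => [|m IH] n.
  rewrite sum_boxesS [LHS]block_pairs [LHS]big_mkcond; apply: eq_bigr => p _.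
  rewrite [RHS]big_mkcond big_seq1 /degs /= !addn0.
  by rewrite /prod_binoms big_seq1.
rewrite sum_boxesS /=.
under eq_bigr => c _ do rewrite block_pairs IH (LL_sum LL_linear).
rewrite (exchange_big_dep xpredT)//=; apply: eq_bigr => p _.
under eq_bigr => c _ do rewrite sandwich_sum scaler_sumr.
rewrite (exchange_big_dep xpredT)//= [RHS]big_mkcond !big_seq.
apply: eq_bigr => s sb; have sz : size s = m.+1 by exact: (@size_boxes K).
have Dps : degs (p :: s) = (deg p + degs s)%N by [].
case: ifP => [/eqP E|E].
  have pn : (deg p < n)%N by lia.
  rewrite (big_pred1 (Ordinal pn)).
    rewrite (LLZ LL_linear) sandwichZ scalerA -natrM -wordS ?sz//.
    by rewrite /prod_binoms big_cons.
  by move=> c; rewrite /= -val_eqE /=; have := ltn_ord c; lia.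
apply: big1 => c /andP[/eqP Ep /eqP Es]; case/negP: (negbT E).
by have := ltn_ord c; lia.
Qed.

(** The integral over the simplex of the monomial in the gaps that is attached to
    s, by integral_simplex_gaps. *)
Definition dirichlet m (s : seq (nat * nat)) : R :=
  (\prod_(p <- s) (deg p)`!)%N%:R / ((degs s + m)`!)%:R.

(** On the left, the coefficient of a word in the exponential series; on the right,
    its coefficient in the Dyson series.  This identity is what allows the
    simplex integrals of operators to be avoided. *)
Lemma prod_binomsE m s :
  (prod_binoms s)%:R / ((degs s + m)`!)%:R = dirichlet m s / (prod_facts s)%:R :> R.
Proof.
have f0 n : n`!%:R != 0 :> R by rewrite pnatr_eq0 -lt0n fact_gt0.
have F0 : (prod_facts s)%:R != 0 :> R.
  rewrite /prod_facts; elim: s => [|p s IH]; first by rewrite big_nil oner_eq0.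
  by rewrite big_cons !natrM !mulf_neq0.
rewrite /dirichlet mulrAC; congr (_ / _); apply: (canRL (mulfK F0)).
rewrite -natrM; congr _%:R; rewrite /prod_binoms /prod_facts -big_split; apply: eq_bigr.
by move=> p _ /=; rewrite /deg -{2}(addKn p.1 p.2) bin_fact ?leq_addr.
Qed.
Variables (j l : R).
Hypotheses (j0 : 0 <= j) (Jj : opbounded J j) (l0 : 0 <= l).
Hypothesis LLl : forall X, schatten1 (LL X) <= l * schatten1 X.

Lemma word_bound m s X : size s = m.+1 ->
  schatten1 (word s X) <= j ^+ degs s * l ^+ m * schatten1 X.
Proof.
elim: m s => [|m IH] [|p s]//=.
  case: s => // _; rewrite /degs /= addn0 mulr1.
  exact: sandwich_bound.
move=> [sz]; have -> : (if s is [::] then X else LL (word s X)) = LL (word s X).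
  by case: s sz.
apply: le_trans (sandwich_bound j0 Jj _ _ _) _.
rewrite -[degs (p :: s)]/(p.1 + p.2 + degs s)%N (exprD j (p.1 + p.2)) -!mulrA.
apply: ler_wpM2l; first by rewrite exprn_ge0.
apply: le_trans (LLl _) _; rewrite exprS -mulrA mulrCA; apply: ler_wpM2l => //.
by rewrite mulrA; exact: IH.
Qed.
End expansion.

(** * Quadrature error on words of high degree *)

Section box_sums.
Context {V : nmodType}.

(** A common recursive form for the sum over functions that defines combC and the
    sum over lists of pairs of exponents: both only see the sum and the product
    of factorials of the exponents. *)
Fixpoint box_sum K N (G : nat -> nat -> V) : V :=
  if N is N'.+1 then
    \sum_(a < K) box_sum K N' (fun u v => G (a + u)%N (a`! * v)%N)
  else G 0%N 1%N.

Definition fcons T N (p : T * {ffun 'I_N -> T}) : {ffun 'I_N.+1 -> T} :=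
  [ffun i => if unlift ord0 i is Some i' then p.2 i' else p.1].

Lemma sum_ffun_box K N (G : nat -> nat -> V) :
  \sum_(x : {ffun 'I_N -> 'I_K}) G (\sum_i x i)%N (\prod_i (x i)`!)%N =
  box_sum K N G.
Proof.
elim: N G => [|N IH] G /=.
  rewrite (eq_bigr (fun=> G 0%N 1%N)); last by move=> x _; rewrite !big_ord0.
  by rewrite sumr_const card_ffun !card_ord expn0 mulr1n.
under [RHS]eq_bigr => a _ do rewrite -IH.
rewrite pair_big /= (reindex (@fcons _ N)) /=.
  apply: eq_bigr => -[a y] _ /=; rewrite !big_ord_recl /fcons !ffunE unlift_none.
  by congr (G (_ + _)%N (_ * _)%N); apply: eq_bigr => i _; rewrite ffunE liftK.
exists (fun x => (x ord0, [ffun i => x (lift ord0 i)])).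
  move=> [a y] _; rewrite /fcons !ffunE unlift_none; congr pair.
  by apply/ffunP => i; rewrite !ffunE liftK.
move=> x _; apply/ffunP => i; rewrite !ffunE.
by case: unliftP => [i' ->|->] /=; rewrite ?ffunE.
Qed.

Lemma sum_boxes_box K m (G : nat -> nat -> V) :
  \sum_(s <- boxes K m) G (degs s) (prod_facts s) = box_sum K (2 * m) G.
Proof.
elim: m G => [|m IH] G.
  by rewrite muln0 big_seq1 /prod_facts big_nil.
rewrite sum_boxesS mulnS /= sum_pairs; apply: eq_bigr => a _.
apply: eq_bigr => b _; rewrite -IH; apply: eq_bigr => s _.
rewrite /prod_facts big_cons -[degs (_ :: _)]/(deg _ + degs s)%N /deg /=.
by rewrite -addnA -mulnA.
Qed.
End box_sums.

Lemma combC_boxes (R : realType) M m : combC M m =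
  \sum_(s <- boxes (M - m).+1 m.+1 | (M - m < degs s)%N) ((prod_facts s)%:R)^-1 :> R.
Proof.
pose G u v : R := if (M - m < u)%N then (v%:R)^-1 else 0.
rewrite [RHS]big_mkcond -[RHS]/(\sum_(s <- _) G (degs s) (prod_facts s)).
rewrite sum_boxes_box mulnS addnC -sum_ffun_box /combC big_mkcond.
by apply: eq_bigr => x _; rewrite /G addn1.
Qed.

Section quadrature_bounds.
Context {R : realType}.
Implicit Types (s t : seq (nat * nat)) (g : nat -> R).

Lemma gap_monomial_ge0 g s : (forall i, (i < size s)%N -> 0 <= g i) -> 0 <= gap_monomial g s.
Proof.
elim: s => [//|p s IH] g0 /=; rewrite mulr_ge0 ?exprn_ge0 ?g0//.
by apply: IH => i si; rewrite g0//= ltnW.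
Qed.

(** The gaps are at most 1, so lowering exponents increases the monomial; the same
    lowered exponents serve for all nodes. *)
Lemma gap_monomial_shrink s n : (n <= degs s)%N ->
  exists t, [/\ size t = size s, degs t = n &
    forall g, (forall i, (i < size s)%N -> 0 <= g i <= 1) -> gap_monomial g s <= gap_monomial g t].
Proof.
elim: s n => [|p s IH] n; first by rewrite leqn0 => /eqP ->; exists [::].
rewrite -[degs (p :: s)]/(deg p + degs s)%N => nle.
have [|t [st dt gt]] := IH (n - minn n (deg p))%N; first by lia.
exists ((minn n (deg p), 0%N) :: t); split => [||g g01] /=; first by rewrite st.
  by rewrite -[degs (_ :: t)]/(deg _ + degs t)%N dt /deg /=; lia.
have g01s i : (i < size s)%N -> 0 <= g i <= 1 by move=> si; rewrite g01//= ltnW.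
have /andP[gs0 gs1] : 0 <= g (size s) <= 1 by rewrite g01//=.
rewrite st ler_pM ?exprn_ge0 ?gap_monomial_ge0 ?gt//.
  by move=> i /g01s /andP[].
by rewrite /deg /= addn0 ler_wiXn2l// geq_minr.
Qed.

Lemma fact_leq_mul a b : (a`! * b`! <= (a + b)`!)%N.
Proof.
have := bin_fact (leq_addr b a); rewrite addKn => <-.
by rewrite leq_pmull// bin_gt0 leq_addr.
Qed.

Lemma prod_fact_degs_le s : (\prod_(p <- s) (deg p)`! <= (degs s)`!)%N.
Proof.
elim: s => [|p s IH]; first by rewrite big_nil.
rewrite big_cons (leq_trans (leq_mul (leqnn _) IH))//.
exact: fact_leq_mul.
Qed.

Lemma dirichlet_ge0 m s : 0 <= dirichlet m s :> R.
Proof. by rewrite divr_ge0. Qed.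

Lemma dirichlet_le m s n : (n <= degs s)%N ->
  dirichlet m s <= n`!%:R / (n + m)`!%:R :> R.
Proof.
move=> ns; have f0 i : 0 < i`!%:R :> R by rewrite ltr0n fact_gt0.
rewrite /dirichlet ler_pdivrMr// mulrAC ler_pdivlMr// -!natrM ler_nat.
apply: leq_trans (leq_mul (prod_fact_degs_le s) (leqnn _)) _.
move: (degs s) ns => t nt.
have F i : ((i + m)`! = 'C(i + m, m) * (m`! * i`!))%N.
  by rewrite -{3}(addnK m i) bin_fact// leq_addl.
rewrite (F n) (F t) (mulnCA t`!) (mulnCA n`!); apply: leq_mul.
  by rewrite leq_bin2l// leq_add2r.
by apply: eq_leq; ring.
Qed.

Lemma gap_monomialE g s : gap_monomial g s =
  \prod_(i < size s) g i ^+ nth 0%N (rev (map deg s)) i.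
Proof.
elim: s => [|p s IH]; first by rewrite big_ord0.
rewrite /= big_ord_recr /= IH rev_cons nth_rcons size_rev size_map ltnn eqxx.
rewrite mulrC; congr (_ * _); apply: eq_bigr => i _.
by rewrite nth_rcons size_rev size_map ltn_ord.
Qed.

Lemma sum_rev_nth s : (\sum_(i < size s) nth 0 (rev (map deg s)) i = degs s)%N.
Proof.
elim: s => [|p s IH]; first by rewrite big_ord0.
rewrite /= big_ord_recr /= rev_cons nth_rcons size_rev size_map ltnn eqxx addnC.
congr addn; apply: etrans IH; apply: eq_bigr => i _.
by rewrite nth_rcons size_rev size_map ltn_ord.
Qed.

Lemma prod_rev_nth s :
  (\prod_(i < size s) (nth 0 (rev (map deg s)) i)`! = \prod_(p <- s) (deg p)`!)%N.
Proof.
elim: s => [|p s IH]; first by rewrite big_ord0 big_nil.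
rewrite /= big_ord_recr /= rev_cons nth_rcons size_rev size_map ltnn eqxx mulnC.
rewrite big_cons -IH; congr muln; apply: eq_bigr => i _.
by rewrite nth_rcons size_rev size_map ltn_ord.
Qed.

(** The quadrature of the monomial attached to s, with gaps g q at the node q. *)
Definition quad Q (w : 'I_Q -> R) (g : 'I_Q -> nat -> R) s : R :=
  \sum_q w q * gap_monomial (g q) s.

(** Both numbers lie between 0 and n! / (n + m)!: the integral because Dirichlet
    integrals decrease with the degree, the quadrature because the degree can be
    lowered to n, where it is exact. *)
Lemma quad_dirichlet_high Q (w : 'I_Q -> R) (g : 'I_Q -> nat -> R) m n s :
  (forall q, 0 < w q) -> (forall q i, (i <= m)%N -> 0 <= g q i <= 1) ->
  (forall t, size t = m.+1 -> degs t = n -> quad w g t = dirichlet m t) ->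
  size s = m.+1 -> (n <= degs s)%N ->
  `|quad w g s - dirichlet m s| <= n`!%:R / (n + m)`!%:R.
Proof.
move=> w0 g01 ex sz nle.
have [t [st dt gt]] := gap_monomial_shrink nle.
have g01s q i : (i < size s)%N -> 0 <= g q i <= 1 by rewrite sz ltnS; exact: g01.
have Q0 : 0 <= quad w g s.
  rewrite sumr_ge0// => q _; rewrite mulr_ge0 ?gap_monomial_ge0 ?(ltW (w0 _))//.
  by move=> i /(g01s q) /andP[].
have Qle : quad w g s <= n`!%:R / (n + m)`!%:R.
  apply: (@le_trans _ _ (quad w g t)).
    by apply: ler_sum => q _; rewrite ler_pM2l// gt//; exact: g01s.
  by rewrite ex ?st// dirichlet_le ?dt.
have := dirichlet_le m nle; have := dirichlet_ge0 m s.
by move=> D0 Dle; rewrite ler_norml; apply/andP; split; lra.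
Qed.
End quadrature_bounds.

Section chain_error.
Context {R : realType} {d : nat}.
Local Notation C := R[i].
Implicit Types (X Y W : 'M[C]_d).
Variables (J : 'M[C]_d) (j : R) (LL : 'M[C]_d -> 'M[C]_d) (l : R).
Hypotheses (j0 : 0 <= j) (Jj : opbounded J j) (l0 : 0 <= l).
Hypotheses (LL_linear : linear LL)
  (LLl : forall X, schatten1 (LL X) <= l * schatten1 X).

Lemma taylor_boxes K m N dt X :
  (forall s, s \in boxes K m.+1 -> (degs s + m <= N)%N) ->
  \sum_(i < N.+1) (dt ^+ i / i`!%:R)%:C *: jumped J LL (below K) m i X =
  \sum_(s <- boxes K m.+1)
    (dt ^+ m * (dt ^+ degs s * dirichlet m s / (prod_facts s)%:R))%:C *:
    word J LL s X.
Proof.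
move=> sN.
under eq_bigr => i _ do rewrite (jumped_boxes _ LL_linear) scaler_sumr.
rewrite (exchange_big_dep xpredT)//= !big_seq; apply: eq_bigr => s sb.
have sNs : (degs s + m < N.+1)%N by rewrite ltnS; exact: sN.
rewrite (big_pred1 (Ordinal sNs)) /=; last by move=> i; rewrite /= -val_eqE /= eq_sym.
rewrite scalerA -(rmorph_nat (real_complex R)) -rmorphM; congr (_%:C *: _).
rewrite -[_ * _ / (prod_facts s)%:R]mulrA -prod_binomsE exprD.
by ring.
Qed.

(** Exactness removes the words with at most n letters besides the jumps; on the
    others the weights differ by at most b, and dt * j <= 1 bounds the surplus
    powers of J. *)
Lemma chain_error n m N dt (qv : seq (nat * nat) -> R) b X :
  0 <= dt -> dt * j <= 1 ->
  (forall s, s \in boxes n.+1 m.+1 -> (degs s + m <= N)%N) ->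
  (forall s, s \in boxes n.+1 m.+1 -> (degs s <= n)%N -> qv s = dirichlet m s) ->
  (forall s, s \in boxes n.+1 m.+1 -> (n < degs s)%N ->
    `|qv s - dirichlet m s| <= b) ->
  schatten1 ((dt ^+ m)%:C *: (\sum_(s <- boxes n.+1 m.+1)
      (dt ^+ degs s * qv s / (prod_facts s)%:R)%:C *: word J LL s X)
    - \sum_(i < N.+1) (dt ^+ i / i`!%:R)%:C *: jumped J LL (below n.+1) m i X) <=
  b * (\sum_(s <- boxes n.+1 m.+1 | (n < degs s)%N) ((prod_facts s)%:R)^-1) *
    ((dt * l) ^+ m * (dt * j) ^+ n.+1) * schatten1 X.
Proof.
move=> dt0 dtj sN low high; rewrite taylor_boxes// scaler_sumr -sumrB.
rewrite (le_trans (schatten1_sum _ _ _))// !mulr_sumr !mulr_suml.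
rewrite [leRHS]big_mkcond !big_seq; apply: ler_sum => s sb.
rewrite scalerA -scalerBl -rmorphM -rmorphB schatten1Zr.
have -> : dt ^+ m * (dt ^+ degs s * qv s / (prod_facts s)%:R) -
    dt ^+ m * (dt ^+ degs s * dirichlet m s / (prod_facts s)%:R) =
    (qv s - dirichlet m s) / (prod_facts s)%:R * (dt ^+ m * dt ^+ degs s) by ring.
case: ltnP => [sn|sn]; last by rewrite low// subrr !mul0r normr0 mul0r.
have f0 : 0 <= ((prod_facts s)%:R)^-1 :> R by rewrite invr_ge0.
have c0 : 0 <= dt ^+ m * dt ^+ degs s by rewrite mulr_ge0 ?exprn_ge0.
have Wle : dt ^+ m * dt ^+ degs s * schatten1 (word J LL s X) <=
    (dt * l) ^+ m * (dt * j) ^+ n.+1 * schatten1 X.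
  have wb := word_bound j0 Jj l0 LLl X (size_boxes sb).
  apply: le_trans (ler_wpM2l c0 wb) _; rewrite mulrA.
  apply: ler_wpM2r; first exact: schatten1_ge0.
  have -> : dt ^+ m * dt ^+ degs s * (j ^+ degs s * l ^+ m) =
     (dt * l) ^+ m * (dt * j) ^+ degs s by rewrite !exprMn; ring.
  apply: ler_wpM2l; first by rewrite exprn_ge0// mulr_ge0.
  by apply: ler_wiXn2l => //; rewrite mulr_ge0.
rewrite normrM (ger0_norm c0) normrM (ger0_norm f0) -[leLHS]mulrA -[leRHS]mulrA.
apply: (ler_pM _ _ _ Wle).
- by rewrite mulr_ge0.
- by rewrite mulr_ge0 ?schatten1_ge0.
- by apply: ler_wpM2r => //; exact: high.
Qed.
End chain_error.

(** * Integrals over the simplex *)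

Section beta.
Context {R : realType}.

(** Repeated integration by parts, decreasing the exponent a. *)
Lemma beta_antiderivative (u : R) a n : exists F : {poly R},
  [/\ F^`() = ('X - u%:P) ^+ a * (1 - 'X) ^+ n, F.[1] = 0 &
      F.[u] = - ((a`! * n`!)%:R / (a + n).+1`!%:R * (1 - u) ^+ (a + n).+1)].
Proof.
have f0 i : i`!%:R != 0 :> R by rewrite pnatr_eq0 -lt0n fact_gt0.
have dX k : ((1 - 'X) ^+ k.+1)^`() = - (k.+1%:R *: (1 - 'X : {poly R}) ^+ k).
  rewrite deriv_exp derivB derivX (derivC 1) sub0r.
  by rewrite mulN1r mulNrn scaler_nat.
have dXu k : (('X - u%:P) ^+ k.+1)^`() = k.+1%:R *: ('X - u%:P : {poly R}) ^+ k.
  by rewrite deriv_exp derivB derivX derivC subr0 mul1r scaler_nat.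
elim: a n => [|a IH] n.
  have n0 : n.+1%:R != 0 :> R by rewrite pnatr_eq0.
  exists (- (n.+1%:R^-1 *: (1 - 'X) ^+ n.+1)); split.
  - by rewrite derivN derivZ dX scalerN opprK scalerA mulVf// scale1r mul1r.
  - by rewrite !hornerE subrr exprS mul0r mulr0 oppr0.
  - rewrite !hornerE; congr (- (_ * _)).
    by rewrite factS natrM invfM mulrC -mulrA mulVf// mulr1.
have [F [F' F1 Fu]] := IH n.+1.
have n0 : n.+1%:R != 0 :> R by rewrite pnatr_eq0.
exists (n.+1%:R^-1 *: (a.+1%:R *: F - ('X - u%:P) ^+ a.+1 * (1 - 'X) ^+ n.+1)).
split.
- rewrite derivZ derivB derivZ derivM F' dX dXu -scalerAl opprD addNKr.
  by rewrite mulrN opprK -scalerAr scalerA mulVf// scale1r.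
- by rewrite !hornerE F1 subrr (expr0n _ n.+1) !mulr0 subrr mulr0.
- transitivity (n.+1%:R^-1 * (a.+1%:R * F.[u])).
    by rewrite !hornerE subrr (expr0n _ a.+1) mul0r subr0 mulrA.
  rewrite Fu addnS addSn.
  move: ((1 - u) ^+ (a + n).+2) (f0 (a + n).+2) => E.
  move: ((a + n).+2`!%:R : R) => B B0.
  by rewrite (factS a) (factS n) !natrM; field; rewrite B0 -?nat1r ?n0 ?nat1r ?n0 ?natr1 ?n0.
Qed.

Lemma beta_integral (u c : R) a n : u <= 1 ->
  (\int[lebesgue_measure]_(x in `[u, 1%R]) (c * ((x - u) ^+ a * (1 - x) ^+ n))%:E
   = (c * ((a`! * n`!)%:R / (a + n).+1`!%:R * (1 - u) ^+ (a + n).+1))%:E)%E.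
Proof.
have [F [F' F1 Fu]] := beta_antiderivative u a n.
rewrite le_eqVlt => /orP[/eqP ->|u1].
  rewrite set_itv1 subrr (expr0n _ (_ + _).+1) !mulr0.
  exact: integral_set1.
have E x : c * ((x - u) ^+ a * (1 - x) ^+ n) = (c *: F)^`().[x].
  by rewrite derivZ F' !hornerE.
under eq_integral => x _ do rewrite E.
have Fc (p : {poly R}) : continuous (horner p).
  by move=> x; exact/differentiable_continuous/derivable1_diffP/derivable_horner.
rewrite (@continuous_FTC2 _ _ (horner (c *: F)))//.
- by rewrite !hornerZ F1 Fu mulr0 sub0e mulrN -EFinN opprK.
- by apply: continuous_subspaceT; exact: Fc.
- split.
  + by move=> x _; exact: derivable_horner.
  + by apply: cvg_at_right_filter; exact: Fc.
  + by apply: cvg_at_left_filter; exact: Fc.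
- by move=> x _; rewrite derivE.
Qed.
End beta.

Section simplex_integral.
Context {R : realType}.
Local Notation Rm := (measurableTypeR R).

(** The integrand extended by 0 outside the simplex u <= s_1 <= ... <= s_m <= 1.
    The lower end u is a parameter so that integrating over the tail of s gives
    again a function of this kind of the head. *)
Fixpoint simplex_monomial (g : nat -> nat) (u : R) (s : seq R) : R :=
  if s is x :: s' then
    if u <= x then (x - u) ^+ g 0%N * simplex_monomial (fun i => g i.+1) x s' else 0
  else if u <= 1 then (1 - u) ^+ g 0%N else 0.

Lemma simplex_monomial_ge0 g u s : 0 <= simplex_monomial g u s.
Proof.
elim: s g u => [|x s IH] g u /=; case: ifP => // ux.
  by rewrite exprn_ge0 ?subr_ge0.
by rewrite mulr_ge0 ?exprn_ge0 ?subr_ge0.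
Qed.

Lemma measurable_simplex_monomial m g :
  measurable_fun setT
    (fun p : Rm * m.-tuple Rm => simplex_monomial g p.1 p.2).
Proof.
elim: m g => [|m IH] g.
  rewrite (_ : (fun _ => _) = (fun p : Rm * 0.-tuple Rm =>
      if p.1 <= 1 then (1 - p.1) ^+ g 0%N else 0)); last first.
    by apply/funext => -[x t] /=; rewrite (tuple0 t).
  apply: measurable_fun_ifT => //.
    by apply: measurable_fun_ler => //; exact: measurable_fst.
  by apply: measurable_funX; apply: measurable_realfun.measurable_funB => //; exact: measurable_fst.
pose hd (p : Rm * m.+1.-tuple Rm) : Rm := tnth p.2 ord0.
pose tl (p : Rm * m.+1.-tuple Rm) : m.-tuple Rm := [tuple of behead p.2].
have mhd : measurable_fun setT hd.
  by apply: (measurableT_comp (measurable_tnth _)); exact: measurable_snd.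
have mtl : measurable_fun setT tl.
  exact: (measurableT_comp (@measurable_behead _ Rm m) measurable_snd).
rewrite (_ : (fun _ => _) = (fun p => if p.1 <= hd p then
    (hd p - p.1) ^+ g 0%N * simplex_monomial (fun i => g i.+1) (hd p) (tl p)
    else 0)); last first.
  apply/funext => -[x t] /=; rewrite /hd /tl /=.
  by case/tupleP: t => y t; rewrite tnth0.
apply: measurable_fun_ifT => //.
  by apply: measurable_fun_ler => //; exact: measurable_fst.
apply: measurable_funM.
  by apply: measurable_funX; apply: measurable_realfun.measurable_funB => //; exact: measurable_fst.
have mht : measurable_fun setT (fun p => (hd p, tl p)).
  exact/measurable_fun_pair.
exact: (measurableT_comp (IH (fun i => g i.+1)) mht).
Qed.

Lemma measurable_simplex_monomial_r m g u :
  measurable_fun setT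
    (EFin \o (fun t : m.-tuple Rm => simplex_monomial g u t)).
Proof.
apply/measurable_EFinP.
have mu : measurable_fun setT (fun t : m.-tuple Rm => (u : Rm, t)).
  exact/measurable_fun_pair.
exact: (measurableT_comp (measurable_simplex_monomial (m := m) g) mu).
Qed.

Definition dirichlet_const m (g : nat -> nat) : R :=
  (\prod_(i < m.+1) (g i)`!)%N%:R / (\sum_(i < m.+1) g i + m)`!%:R.

(** By Tonelli, integrating s_2, ..., s_m first leaves a power of 1 - s_1 by
    induction, and a beta integral remains. *)
Lemma integral_simplex_monomial m g u :
  (\int[lebesgue_tuple m]_s (simplex_monomial g u s)%:E =
   (if u <= 1 then dirichlet_const m g * (1 - u) ^+ (\sum_(i < m.+1) g i + m)
    else 0)%:E)%E.
Proof.
elim: m g u => [|m IH] g u.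
  have f0 i : i`!%:R != 0 :> R by rewrite pnatr_eq0 -lt0n fact_gt0.
  have -> : (fun s : 0.-tuple Rm => (simplex_monomial g u s)%:E) =
      cst (simplex_monomial g u [::])%:E.
    by apply/funext => s; rewrite (tuple0 s).
  rewrite /= integral_dirac// diracT mul1e /dirichlet_const !big_ord1 addn0.
  by rewrite divff// mul1r.
rewrite /= ge0_integral_pushforward//; last first.
- by move=> t _; rewrite lee_fin; exact: (simplex_monomial_ge0 g u t).
- exact: measurable_simplex_monomial_r.
- exact: measurable_tcons.
rewrite preimage_setT fubini_tonelli1/=; last first.
- move=> p; rewrite lee_fin; exact: simplex_monomial_ge0 g u (p.1 :: p.2).
- exact: (measurableT_comp (@measurable_simplex_monomial_r m.+1 g u)
    (@measurable_tcons R m)).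
set c := dirichlet_const m (fun i => g i.+1).
set n := (\sum_(i < m.+1) g i.+1 + m)%N.
have c0 : 0 <= c by rewrite divr_ge0.
have inner x : fubini_F (lebesgue_tuple m) (fun p : Rm * m.-tuple Rm =>
    (if u <= p.1 then (p.1 - u) ^+ g 0%N *
       simplex_monomial (fun i => g i.+1) p.1 p.2 else 0)%:E) x =
    (if u <= x then (x - u) ^+ g 0%N * (if x <= 1 then c * (1 - x) ^+ n else 0)
     else 0)%:E.
  rewrite /fubini_F /=; case: ifP => ux; last exact: integral0.
  under eq_integral => y _ do rewrite EFinM.
  rewrite ge0_integralZl//.
  - by rewrite IH -EFinM.
  - exact: measurable_simplex_monomial_r.
  - by move=> y _; rewrite lee_fin simplex_monomial_ge0.
  - by rewrite lee_fin exprn_ge0// subr_ge0.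
under eq_integral => x _ do rewrite inner.
case: (leP u 1) => [u1|u1]; last first.
  apply: integral0_eq => x _; case: ifP => // ux.
  by rewrite leNgt (lt_le_trans u1 ux) mulr0.
transitivity (\int[lebesgue_measure]_(x in `[u, 1%R])
    (c * ((x - u) ^+ g 0%N * (1 - x) ^+ n))%:E)%E.
  rewrite [RHS]integral_mkcond; apply: eq_integral => x _.
  rewrite patchE mem_setE in_itv /=.
  by case: (u <= x) => //=; case: (x <= 1) => //=; rewrite ?mulr0// mulrCA.
rewrite beta_integral//; congr (_%:E).
have f0 i : i`!%:R != 0 :> R by rewrite pnatr_eq0 -lt0n fact_gt0.
have nE : (\sum_(i < m.+2) g i + m.+1 = (g 0%N + n).+1)%N.
  by rewrite big_ord_recl /= /n addnS addnA.
rewrite mulrA /dirichlet_const nE; congr (_ * _).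
rewrite /c /dirichlet_const -/n [in RHS]big_ord_recl /=.
move: (f0 n) (f0 (g 0%N + n).+1).
move: ((g 0%N + n).+1`!%:R : R) => B A0 B0.
by rewrite natrM; move: (n`!%:R : R) A0 => A A0; rewrite natrM; field; rewrite A0 B0.
Qed.

Lemma simplex_monomial_path g u (s : seq R) :
  simplex_monomial g u s = if path <=%R u (rcons s 1) then
    \prod_(i < (size s).+1)
      (nth 0 (rcons s 1) i - nth 0 (u :: rcons s 1) i) ^+ g i else 0.
Proof.
elim: s g u => [|x s IH] g u /=.
  by rewrite andbT big_ord1.
rewrite IH; case: (u <= x) => //=; case: ifP => _; last by rewrite mulr0.
by rewrite [RHS]big_ord_recl.
Qed.

Lemma simplexP m (s : m.-tuple R) : simplex s <-> path <=%R 0 (rcons s 1).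
Proof.
split=> [h|/(pathP 0) h j jm].
  apply/(pathP 0) => i; rewrite size_rcons size_tuple ltnS => im.
  exact: (h i im).
by apply: h; rewrite size_rcons size_tuple ltnS.
Qed.

Lemma integral_simplex_gaps m (g : nat -> nat) :
  (\int[lebesgue_tuple m]_(x in @simplex R m)
     (\prod_(j < m.+1) gap x j ^+ g j)%:E = (dirichlet_const m g)%:E)%E.
Proof.
transitivity (\int[lebesgue_tuple m]_x (simplex_monomial g 0 x)%:E)%E.
  rewrite integral_mkcond; apply: eq_integral => x _.
  rewrite simplex_monomial_path patchE size_tuple.
  have [xs|xs] := boolP (x \in (@simplex R m)).
    by rewrite (simplexP x).1//; exact: set_mem.
  rewrite ifF//; apply/negP => /simplexP xp; case/negP: xs.
  exact/mem_set.
by rewrite integral_simplex_monomial ler01 subr0 expr1n mulr1.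
Qed.

Lemma exact_quadratureE m n Q (w : 'I_Q -> R) (s : 'I_Q -> m.-tuple R)
    (g : nat -> nat) : exact_quadrature n w s ->
  (\sum_(i < m.+1) g i <= n)%N ->
  \sum_q w q * \prod_(j < m.+1) gap (s q) j ^+ g j = dirichlet_const m g.
Proof.
move=> ex gn; have := ex (fun i => g i) gn.
by rewrite integral_simplex_gaps => -[].
Qed.

Lemma gap_simplex m (s : m.-tuple R) j : simplex s -> (j <= m)%N ->
  0 <= gap s j <= 1.
Proof.
move=> ss jm; have mono i : (i <= m.+1)%N -> 0 <= knot s i.
  elim: i => [//|i IH] im; exact: le_trans (IH (ltnW im)) (ss _ im).
have mono1 i : (i <= m.+1)%N -> knot s (m.+1 - i) <= 1.
  elim: i => [|i IH] im.
    by rewrite subn0 /knot /= nth_rcons size_tuple ltnn eqxx.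
  apply: le_trans (IH (ltnW im)).
  have -> : (m.+1 - i = (m.+1 - i.+1).+1)%N by lia.
  by apply: ss; lia.
rewrite /gap subr_ge0 ss//=.
have := mono j (leqW jm); have := mono1 (m.+1 - j.+1)%N (leq_subr _ _).
by rewrite subKn//; lra.
Qed.
End simplex_integral.

(** * The exponential of a superoperator *)

Section exp_convergence.
Context {R : realType} {d : nat}.
Local Notation C := R[i].
Implicit Types (X Y W E : 'M[C]_d) (u : nat -> 'M[C]_d).

(** Convergence in trace norm, with real thresholds; tends_to_cvg relates it to
    the topology of the complex matrices. *)
Definition tends_to u E :=
  forall e : R, 0 < e -> exists N, forall n, (N <= n)%N -> schatten1 (u n - E) <= e.

Lemma tends_to_entries u E :
  (forall e : R, 0 < e -> exists N, forall n, (N <= n)%N ->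
     forall i j, normc ((u n - E) i j) <= e) -> tends_to u E.
Proof.
move=> h e e0; have d0 : 0 < (d * d).+1%:R :> R by [].
have [N hN] := h (e / (d * d).+1%:R) (divr_gt0 e0 d0).
exists N => n Nn; rewrite (le_trans (schatten1_entries _))//.
apply: (@le_trans _ _ (\sum_(i < d) \sum_(j < d) e / (d * d).+1%:R)).
  by apply: ler_sum => i _; apply: ler_sum => j _; exact: hN.
rewrite !sumr_const !card_ord -mulrnA -[_ *+ (d * d)]mulr_natl mulrCA ler_piMr ?(ltW e0)//.
by rewrite ler_pdivrMr// mul1r ler_nat.
Qed.

Local Notation V := ('M[C]_d : normedModType C).

Lemma tends_to_cvg u E : tends_to u E <-> u @ \oo --> (E : V).
Proof.
split=> [h|/(@cvg_ballP C V) h].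
  apply/(@cvg_ballP C V) => e e0.
  have [e' ee'] : exists e' : R, e = e'%:C.
    by apply/complex_realP; exact: gtr0_real.
  move: e0; rewrite ee' ltcR => e0.
  have [N hN] := h (e' / 2) (divr_gt0 e0 (ltr0Sn _ 1)).
  exists N => // n /= Nn; split=> [|i j]; first by rewrite ltcR.
  rewrite -ball_normE /= distrC norm_normc ltcR.
  have := normc_entry (u n - E) i j; rewrite !mxE => h1.
  apply: (le_lt_trans h1); apply: (le_lt_trans (hN _ Nn)).
  by rewrite ltr_pdivrMr// ltr_pMr// ltr1n.
apply: tends_to_entries => e e0.
have e0' : 0 < e%:C :> C by rewrite ltcR.
have [N _ hN] := h _ e0'.
exists N => n Nn i j; have [_ /(_ i j)] := hN n Nn.
by rewrite -ball_normE /= distrC norm_normc ltcR !mxE => /ltW.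
Qed.

(** The real and imaginary parts of each entry converge absolutely. *)
Lemma summable_series_tends_to u (b : nat -> R) :
  (forall n, schatten1 (u n) <= b n) -> cvgn (series b) ->
  exists E, tends_to (series u) E.
Proof.
move=> ub bc.
have cv (f : C -> R) : (forall z, `|f z| <= normc z) ->
    forall i j, cvgn (series (fun n => f (u n i j))).
  move=> fz i j; apply: normed_cvg; apply: (series_le_cvg _ _ _ bc) => n /=.
  - exact: normr_ge0.
  - by rewrite (le_trans _ (ub n))// schatten1_ge0.
  - by rewrite (le_trans (fz _))// (le_trans (normc_entry _ _ _)).
have Rc := cv _ abs_Re_le; have Ic := cv _ abs_Im_le.
pose E : 'M[C]_d := \matrix_(i, j) Complex
  (limn (series (fun n => complex.Re (u n i j))))
  (limn (series (fun n => complex.Im (u n i j)))).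
exists E; apply: tends_to_entries => e e0.
have e20 : 0 < e / 2 by rewrite divr_gt0.
have nearE (f : C -> R) (fz : forall z, `|f z| <= normc z) :
    \forall n \near \oo, forall ij : 'I_d * 'I_d,
    `|limn (series (fun n => f (u n ij.1 ij.2))) -
      series (fun n => f (u n ij.1 ij.2)) n| <= e / 2.
  apply: filter_forall => ij.
  by have /cvgrPdist_le/(_ _ e20) := cv f fz ij.1 ij.2.
have [N _ hN] := filterI (nearE _ abs_Re_le) (nearE _ abs_Im_le).
exists N => n /hN[hRe hIm] i j.
rewrite -normcN; apply: le_trans (normc_Re_Im _) _.
rewrite [e]splitr; apply: lerD.
  apply: le_trans (hRe (i, j)); rewrite le_eqVlt; apply/orP; left; apply/eqP.
  congr (`|_|); rewrite /series /= !mxE opprB raddfB /= summxE.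
  by rewrite (raddf_sum (@complex.Re R)).
apply: le_trans (hIm (i, j)); rewrite le_eqVlt; apply/orP; left; apply/eqP.
congr (`|_|); rewrite /series /= !mxE opprB raddfB /= summxE.
by rewrite (raddf_sum (@complex.Im R)).
Qed.

Lemma tends_to_le u E Y (b : R) N : tends_to u E ->
  (forall n, (N <= n)%N -> schatten1 (u n - Y) <= b) -> schatten1 (E - Y) <= b.
Proof.
move=> uE h; apply/ler_addgt0Pr => e e0; have [N1 h1] := uE e e0.
pose n := maxn N N1.
have -> : E - Y = (u n - Y) - (u n - E) by rewrite opprB [RHS]addrC addrA subrK.
apply: le_trans (schatten1B _ _) _.
by apply: lerD; [apply: h|apply: h1]; rewrite ?leq_maxl ?leq_maxr.
Qed.
Lemma tends_to_near u v E : tends_to u E ->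
  (forall e : R, 0 < e -> exists N, forall n, (N <= n)%N ->
     schatten1 (v n - u n) <= e) -> tends_to v E.
Proof.
move=> uE h e e0; have e2 : 0 < e / 2 by rewrite divr_gt0.
have [N1 h1] := uE _ e2; have [N2 h2] := h _ e2.
exists (maxn N1 N2) => n; rewrite geq_max => /andP[/h1 n1 /h2 n2].
have -> : v n - E = (v n - u n) + (u n - E) by rewrite addrA subrK.
by rewrite [e]splitr; apply: le_trans (schatten1D _ _) (lerD n2 n1).
Qed.

Lemma schatten1_arbitrarily_small X Y : (forall e : R, 0 < e -> schatten1 (X - Y) <= e) -> X = Y.
Proof.
move=> h; apply/eqP; rewrite -subr_eq0; apply/eqP/schatten1_eq0/le_anti.
by rewrite schatten1_ge0 andbT; apply/ler_addgt0Pr => e e0; rewrite add0r h.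
Qed.

Lemma tends_to_unique u E F : tends_to u E -> tends_to u F -> E = F.
Proof.
move=> uE uF; apply: schatten1_arbitrarily_small => e e0.
by have [N hN] := uF e e0; exact: tends_to_le uE hN.
Qed.

Lemma tends_to_sub u v E F : tends_to u E -> tends_to v F ->
  tends_to (fun n => u n - v n) (E - F).
Proof.
move=> uE vF e e0; have e2 : 0 < e / 2 by rewrite divr_gt0.
have [N1 h1] := uE _ e2; have [N2 h2] := vF _ e2.
exists (maxn N1 N2) => n; rewrite geq_max => /andP[/h1 n1 /h2 n2].
have -> : u n - v n - (E - F) = (u n - E) - (v n - F) 
    by rewrite !opprB [F - E]addrC addrACA [- v n + F]addrC.
by rewrite [e]splitr; apply: le_trans (schatten1B _ _) (lerD n1 n2).
Qed.
End exp_convergence.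

Lemma sum_triangle (U : nmodType) n (F : nat -> nat -> U) :
  \sum_(k < n) \sum_(a < k.+1) F a (k - a)%N =
  \sum_(a < n) \sum_(b < n | (a + b < n)%N) F a b.
Proof.
have inner (k : 'I_n) : \sum_(a < k.+1) F a (k - a)%N =
    \sum_(a < n) \sum_(b < n | (a + b == k)%N) F a b.
  rewrite (big_ord_widen n (fun a => F a (k - a)%N) (ltn_ord k)) big_mkcond.
  apply: eq_bigr => a _; have kn := ltn_ord k; case: ifP => ak.
    have ba : (k - a < n)%N by lia.
    rewrite (big_pred1 (Ordinal ba))//= => b; rewrite /= -val_eqE /=; lia.
  by rewrite big1// => b /eqP; lia.
under eq_bigr => k _ do rewrite inner.
rewrite exchange_big; apply: eq_bigr => a _ /=.
rewrite (exchange_big_dep xpredT)//= [RHS]big_mkcond; apply: eq_bigr => b _.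
case: ifP => abn; last by rewrite big1// => k /eqP kE; have := ltn_ord k; lia.
by rewrite (big_pred1 (Ordinal abn))// => k; rewrite /= -val_eqE /= eq_sym.
Qed.

Lemma expr_sum_over_fact (R : realType) (s t : R) k :
  (s + t) ^+ k / k`!%:R =
  \sum_(a < k.+1) (s ^+ a / a`!%:R) * (t ^+ (k - a) / (k - a)`!%:R).
Proof.
have f0 i : i`!%:R != 0 :> R by rewrite pnatr_eq0 -lt0n fact_gt0.
rewrite addrC exprDn mulr_suml; apply: eq_bigr => a _.
have ak : (a <= k)%N by rewrite -ltnS.
rewrite -mulr_natr -(bin_fact ak) !natrM.
have B0 : 'C(k, a)%:R != 0 :> R by rewrite pnatr_eq0 -lt0n bin_gt0.
by field; rewrite B0 !f0.
Qed.

Section exponential.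
Context {R : realType} {d : nat}.
Local Notation C := R[i].
Implicit Types (X Y W : 'M[C]_d) (t : R).
Local Notation V := ('M[C]_d : normedModType C).
Variables (G : 'M[C]_d -> 'M[C]_d) (c : R).
Hypotheses (G_linear : linear G) (c0 : 0 <= c).
Hypothesis Gc : forall X, schatten1 (G X) <= c * schatten1 X.

Definition taylor n t X := \sum_(k < n) (t ^+ k / k`!%:R)%:C *: iter k G X.

Lemma iter_bound n X : schatten1 (iter n G X) <= c ^+ n * schatten1 X.
Proof.
elim: n => [|n IH]; first by rewrite expr0 mul1r.
rewrite iterS exprS -mulrA; apply: le_trans (Gc _) _.
exact: ler_wpM2l.
Qed.

Lemma iter_linear n z X Y :
  iter n G (z *: X + Y) = z *: iter n G X + iter n G Y.
Proof. by elim: n => [//|n IH]; rewrite !iterS IH G_linear. Qed.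

Lemma taylor_term_bound k t X : 0 <= t ->
  schatten1 ((t ^+ k / k`!%:R)%:C *: iter k G X) <=
  (t * c) ^+ k / k`!%:R * schatten1 X.
Proof.
move=> t0; have tk : 0 <= t ^+ k / k`!%:R by rewrite divr_ge0 ?exprn_ge0.
rewrite schatten1Zr (ger0_norm tk); apply: le_trans (ler_wpM2l tk (iter_bound k X)) _.
by rewrite exprMn le_eqVlt; apply/orP; left; apply/eqP; ring.
Qed.

Lemma exp_tends_to t X : 0 <= t ->
  tends_to (fun n => taylor n t X) (expsuperop t G X).
Proof.
move=> t0.
have [|E uE] := @summable_series_tends_to R d (fun k => (t ^+ k / k`!%:R)%:C *: iter k G X)
  (fun k => (t * c) ^+ k / k`!%:R * schatten1 X)
  (fun k => taylor_term_bound k X t0).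
  rewrite (_ : (fun k => _) = schatten1 X *: exp_coeff (t * c)).
    exact/is_cvg_seriesZ/is_cvg_series_exp_coeff.
  by apply/funext => k; rewrite /exp_coeff /= mulrC.
have h : tends_to (series (fun k => (t ^+ k / k`!%:R)%:C *: iter k G X))
    (expsuperop t G X).
  apply/tends_to_cvg.
  pose P := fun l : V => series (fun k => (t ^+ k / k`!%:R)%:C *: iter k G X) @ \oo --> l.
  have PE : exists l, P l by exists E; apply/tends_to_cvg.
  exact: (getPex PE).
move=> e e0; have [N hN] := h e e0.
exists N => n /hN; rewrite /taylor /series /= big_mkord; exact.
Qed.

Lemma taylorB n t X Y : taylor n t (X - Y) = taylor n t X - taylor n t Y.
Proof.
rewrite /taylor -sumrB; apply: eq_bigr => k _; rewrite -scalerBr; congr (_ *: _).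
by have := iter_linear k (-1) Y X; rewrite !scaleN1r ![- _ + _]addrC.
Qed.

Definition exp_sum n (x : R) := \sum_(k < n) x ^+ k / k`!%:R.

Lemma exp_sum_series n x : exp_sum n x = series (exp_coeff x) n.
Proof. by rewrite /series /= big_mkord. Qed.

Lemma exp_sum_le n x : 0 <= x -> exp_sum n x <= expR x.
Proof.
move=> x0; rewrite exp_sum_series; apply: nondecreasing_cvgn_le.
  apply/nondecreasing_seqP => k; rewrite /series /= big_nat_recr//= lerDl.
  exact: exp_coeff_ge0.
exact: is_cvg_series_exp_coeff.
Qed.

Lemma taylor_bound n t X : 0 <= t ->
  schatten1 (taylor n t X) <= exp_sum n (t * c) * schatten1 X.
Proof.
move=> t0; apply: le_trans (schatten1_sum _ _ _) _.
by rewrite mulr_suml; apply: ler_sum => k _; exact: taylor_term_bound.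
Qed.

Lemma exp_bound t X : 0 <= t ->
  schatten1 (expsuperop t G X) <= expR (t * c) * schatten1 X.
Proof.
move=> t0; rewrite -[expsuperop _ _ _]subr0.
apply: (@tends_to_le _ _ _ _ _ _ 0%N (exp_tends_to X t0)) => n _.
rewrite subr0; apply: le_trans (taylor_bound n X t0) _.
by apply: ler_wpM2r; [exact: schatten1_ge0|apply/exp_sum_le/mulr_ge0].
Qed.

Lemma expB t X Y : 0 <= t ->
  expsuperop t G (X - Y) = expsuperop t G X - expsuperop t G Y.
Proof.
move=> t0; apply: tends_to_unique (exp_tends_to (X - Y) t0) _.
rewrite (_ : (fun n => _) = (fun n => taylor n t X - taylor n t Y)).
  exact: tends_to_sub (exp_tends_to X t0) (exp_tends_to Y t0).
by apply/funext => n; exact: taylorB.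
Qed.

(** The difference consists of the terms s^a t^b / (a! b!) G^(a + b) with
    a, b < n <= a + b, so it is dominated by the same expression for the scalar
    c in place of G, where the functional equation of expR shows that it tends
    to 0. *)
Lemma taylor_comp_bound n s t X : 0 <= s -> 0 <= t ->
  schatten1 (taylor n (s + t) X - taylor n s (taylor n t X)) <=
  (exp_sum n (s * c) * exp_sum n (t * c) - exp_sum n ((s + t) * c)) * schatten1 X.
Proof.
move=> s0 t0.
pose F a b : 'M[C]_d := ((s ^+ a / a`!%:R) * (t ^+ b / b`!%:R))%:C *: iter (a + b) G X.
pose f a b : R := ((s * c) ^+ a / a`!%:R) * ((t * c) ^+ b / b`!%:R).
have Ff a b : schatten1 (F a b) <= f a b * schatten1 X.
  have q0 : 0 <= s ^+ a / a`!%:R * (t ^+ b / b`!%:R).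
    by rewrite mulr_ge0 ?divr_ge0 ?exprn_ge0.
  rewrite schatten1Zr (ger0_norm q0).
  apply: le_trans (ler_wpM2l q0 (iter_bound _ X)) _.
  by rewrite /f !exprMn exprD le_eqVlt; apply/orP; left; apply/eqP; ring.
have -> : taylor n (s + t) X = \sum_(a < n) \sum_(b < n | (a + b < n)%N) F a b.
  rewrite -sum_triangle; apply: eq_bigr => k _.
  rewrite expr_sum_over_fact rmorph_sum scaler_suml; apply: eq_bigr => a _.
  by rewrite /F subnKC// -ltnS.
have -> : taylor n s (taylor n t X) = \sum_(a < n) \sum_(b < n) F a b.
  rewrite /taylor; apply: eq_bigr => a _.
  have -> : iter a G (taylor n t X) =
      \sum_(b < n) (t ^+ b / b`!%:R)%:C *: iter (a + b) G X.
    rewrite /taylor; elim/big_rec2: _ => [|b Y Z _ <-].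
      by have := iter_linear a (-1) 0 0; rewrite scaler0 addr0 scaleN1r addNr.
    by rewrite iter_linear iterD.
  rewrite scaler_sumr; apply: eq_bigr => b _.
  by rewrite scalerA -rmorphM.
have -> : exp_sum n (s * c) * exp_sum n (t * c) - exp_sum n ((s + t) * c) =
    \sum_(a < n) \sum_(b < n | ~~ (a + b < n)%N) f a b.
  have -> : exp_sum n ((s + t) * c) = \sum_(a < n) \sum_(b < n | (a + b < n)%N) f a b.
    by rewrite -sum_triangle; apply: eq_bigr => k _; rewrite mulrDl expr_sum_over_fact.
  have -> : exp_sum n (s * c) * exp_sum n (t * c) = \sum_(a < n) \sum_(b < n) f a b.
    by rewrite mulr_suml; apply: eq_bigr => a _; rewrite mulr_sumr.
  rewrite -sumrB; apply: eq_bigr => a _.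
  by rewrite (bigID (fun b : 'I_n => (a + b < n)%N))/= addrC addrK.
rewrite -sumrB mulr_suml; apply: le_trans (schatten1_sum _ _ _) _.
apply: ler_sum => a _; rewrite mulr_suml.
rewrite [X in _ - X](bigID (fun b : 'I_n => (a + b < n)%N))/= opprD addrA subrr add0r.
rewrite schatten1N; apply: le_trans (schatten1_sum _ _ _) _.
by apply: ler_sum => b _.
Qed.

Lemma exp_semigroup s t X : 0 <= s -> 0 <= t ->
  expsuperop s G (expsuperop t G X) = expsuperop (s + t) G X.
Proof.
move=> s0 t0; have st0 := addr_ge0 s0 t0.
apply: tends_to_unique (exp_tends_to X st0).
apply: tends_to_near (exp_tends_to _ s0) _ => e e0.
have e2 : 0 < e / 2 by rewrite divr_gt0.
have X1 : 0 < schatten1 X + 1 by rewrite ltr_wpDl// schatten1_ge0.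
have E1 := expR_gt0 (s * c).
have [N1 h1] := exp_tends_to X t0 (divr_gt0 e2 E1).
have cv : (fun n => exp_sum n (s * c) * exp_sum n (t * c) - exp_sum n ((s + t) * c))
    @ \oo --> expR (s * c) * expR (t * c) - expR ((s + t) * c).
  have ex x : (fun n => exp_sum n x) @ \oo --> expR x.
    rewrite (_ : (fun n => _) = series (exp_coeff x)).
      exact: is_cvg_series_exp_coeff.
    by apply/funext => n; rewrite exp_sum_series.
  by apply: cvgB; [apply: cvgM|]; exact: ex.
rewrite mulrDl expRD subrr in cv.
have [N2 _ h2] := (@cvgrPdist_le _ _ _ _ _ _ _).1 cv _ (divr_gt0 e2 X1).
exists (maxn N1 N2) => n; rewrite geq_max => /andP[/h1 n1 /h2 n2].
have -> : taylor n (s + t) X - taylor n s (expsuperop t G X) =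
    (taylor n (s + t) X - taylor n s (taylor n t X)) +
    taylor n s (taylor n t X - expsuperop t G X).
  by rewrite taylorB addrA subrK.
rewrite [e]splitr; apply: le_trans (schatten1D _ _) _; apply: lerD.
  apply: le_trans (taylor_comp_bound _ _ s0 t0) _.
  move: n2; rewrite /= sub0r normrN => n2.
  apply: (@le_trans _ _ (e / 2 / (schatten1 X + 1) * (schatten1 X + 1))).
    apply: (@le_trans _ _ (e / 2 / (schatten1 X + 1) * schatten1 X)).
      apply: ler_wpM2r; first exact: schatten1_ge0.
      by apply: le_trans (ler_norm _) _; rewrite mulrDl.
    by apply: ler_wpM2l; rewrite ?lerDl// divr_ge0// ltW.
  by rewrite divfK// gt_eqF.
apply: le_trans (taylor_bound _ _ s0) _.
apply: (@le_trans _ _ (expR (s * c) * (e / 2 / expR (s * c)))).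
  apply: ler_pM n1; [by apply: sumr_ge0 => k _; rewrite divr_ge0 ?exprn_ge0 ?mulr_ge0| |].
    exact: schatten1_ge0.
  by apply/exp_sum_le/mulr_ge0.
by rewrite mulrC divfK// gt_eqF.
Qed.

Lemma exp0 X : expsuperop 0 G X = X.
Proof.
apply: tends_to_unique (exp_tends_to X (lexx 0)) _ => e e0.
exists 1%N => -[//|n] _; rewrite /taylor big_ord_recl big1 ?addr0.
  by rewrite expr0 divr1 scale1r subrr schatten10 ltW.
by move=> k _; rewrite expr0n mul0r scale0r.
Qed.

Lemma exp_iter n t X : 0 <= t ->
  iter n (expsuperop t G) X = expsuperop (n%:R * t) G X.
Proof.
move=> t0; elim: n => [|n IH]; first by rewrite mul0r exp0.
rewrite iterS IH exp_semigroup ?mulr_ge0//.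
by rewrite -natr1 mulrDl mul1r addrC.
Qed.

Lemma exp_trace t X : 0 <= t -> (forall Y, \tr (G Y) = 0) ->
  \tr (expsuperop t G X) = \tr X.
Proof.
move=> t0 trG; apply/eqP; rewrite -subr_eq0; apply/eqP/Normc.eq0_normc.
apply/le_anti; rewrite normc_ge0 andbT; apply/ler_addgt0Pr => e e0; rewrite add0r.
have [N hN] := exp_tends_to X t0 e0.
have -> : \tr X = \tr (taylor N.+1 t X).
  rewrite /taylor big_ord_recl mxtraceD (raddf_sum (@mxtrace _ _)) big1 ?addr0.
    by rewrite expr0 divr1 scale1r.
  by move=> k _; rewrite /= mxtraceZ trG mulr0.
rewrite -normcN opprB.
have -> : \tr (taylor N.+1 t X) - \tr (expsuperop t G X) =
    \tr (taylor N.+1 t X - expsuperop t G X) by rewrite raddfB.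
by apply: le_trans (normc_tr _) (hN _ _).
Qed.

Lemma exp_euler h X : 0 <= h <= 1 ->
  schatten1 (expsuperop h G X - (X + h%:C *: G X)) <=
  h ^+ 2 * expR c * schatten1 X.
Proof.
move=> /andP[h0 h1].
apply: (@tends_to_le _ _ _ _ _ _ 2%N (exp_tends_to X h0)) => -[//|[//|n]] _.
rewrite /taylor 2!big_ord_recl /= expr0 divr1 scale1r expr1 divr1 addrA.
rewrite [X in X - _]addrC addrK; apply: le_trans (schatten1_sum _ _ _) _.
pose tail := \sum_(k < n) c ^+ k.+2 / k.+2`!%:R.
have tail_le : tail <= expR c.
  apply: le_trans (exp_sum_le n.+2 c0); rewrite /exp_sum 2!big_ord_recl addrA.
  rewrite /tail; under [X in _ <= _ + X]eq_bigr => k _ do rewrite !lift0.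
  by rewrite lerDr !addr_ge0 ?divr_ge0 ?exprn_ge0.
apply: (@le_trans _ _ (h ^+ 2 * tail * schatten1 X)); last first.
  apply: ler_wpM2r; first exact: schatten1_ge0.
  by apply: ler_wpM2l; first exact: exprn_ge0.
rewrite mulr_sumr mulr_suml; apply: ler_sum => k _.
apply: le_trans (taylor_term_bound _ X h0) _.
apply: ler_wpM2r; first exact: schatten1_ge0.
rewrite exprMn -mulrA; apply: ler_wpM2r; first by rewrite divr_ge0 ?exprn_ge0.
exact: ler_wiXn2l.
Qed.
End exponential.

(** * Positivity and contraction of the exponential *)

Section positivity.
Context {R : realType} {d : nat}.
Local Notation C := R[i].
Implicit Types (X Y W : 'M[C]_d) (t h : R).

(** Positivity is a closed condition, tested on entries and on the form at each
    vector. *)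
Lemma psd_closed X : (forall e : R, 0 < e -> exists2 Y, psdmx Y & schatten1 (Y - X) <= e) ->
  psdmx X.
Proof.
move=> hX; split.
  apply/hermP; apply: schatten1_arbitrarily_small => e e0.
  have [Y [/hermP Yh _] Ye] := hX (e / 2) (divr_gt0 e0 (ltr0Sn _ 1)).
  have -> : X^t* - X = (Y - X) - (Y - X)^t*.
    by rewrite linearB /= map_mxB Yh opprB [RHS]addrC addrA subrK.
  rewrite [e]splitr; apply: le_trans (schatten1B _ _) _.
  by rewrite schatten1_adj lerD.
move=> v; set z := (v^t* *m X *m v) 0 0.
have close (e : R) : 0 < e -> exists2 y : R, 0 <= y & normc (y%:C - z) <= e.
  move=> e0; have v1 : 0 < euclid_norm v * euclid_norm v + 1.
    by rewrite ltr_wpDl// mulr_ge0 ?euclid_ge0.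
  have [Y [_ Yp] Ye] := hX _ (divr_gt0 e0 v1).
  exists (complex.Re ((v^t* *m Y *m v) 0 0)).
    by rewrite -ler0c RRe_real ?ger0_real.
  rewrite RRe_real ?ger0_real// /z.
  have -> : (v^t* *m Y *m v) 0 0 - (v^t* *m X *m v) 0 0 =
      (v^t* *m (Y - X) *m v) 0 0 by rewrite mulmxBr mulmxBl !mxE.
  apply: le_trans (normc_quad _ _ _) _.
  apply: (@le_trans _ _ ((euclid_norm v * euclid_norm v + 1) *
    (e / (euclid_norm v * euclid_norm v + 1)))).
    by apply: ler_pM; rewrite ?mulr_ge0 ?euclid_ge0 ?schatten1_ge0 ?lerDl.
  by rewrite mulrC divfK// gt_eqF.
rewrite lecE /=; apply/andP; split.
  rewrite -normr_le0; apply/ler_addgt0Pr => e e0; rewrite add0r.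
  have [y y0 yz] := close e e0; apply: le_trans yz.
  apply: le_trans (abs_Im_le _); by rewrite raddfB /= sub0r normrN.
apply/ler_addgt0Pr => e e0; have [y y0 yz] := close e e0.
have := le_trans (abs_Re_le _) yz; rewrite raddfB /= ler_norml => /andP[_].
by lra.
Qed.

Variables (G : 'M[C]_d -> 'M[C]_d) (c : R).
Hypotheses (G_linear : linear G) (c0 : 0 <= c).
Hypothesis Gc : forall X, schatten1 (G X) <= c * schatten1 X.
Variables (K : 'M[C]_d -> 'M[C]_d) (k : R).
Hypotheses (k0 : 0 <= k) (Kk : forall X, schatten1 (K X) <= k * schatten1 X).

Let B h X := X + h%:C *: G X + (h ^+ 2)%:C *: K X.
Hypothesis K_sub : forall X Y, K (X - Y) = K X - K Y.
Hypothesis B_psd : forall h X, 0 <= h -> psdmx X -> psdmx (B h X).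

Let GB X Y : G (X - Y) = G X - G Y.
Proof. by have := G_linear (-1) Y X; rewrite !scaleN1r ![- _ + _]addrC. Qed.

Lemma euler_bound h X : 0 <= h <= 1 ->
  schatten1 (B h X) <= expR (h * (c + k)) * schatten1 X.
Proof.
move=> /andP[h0 h1].
apply: (@le_trans _ _ ((1 + h * (c + k)) * schatten1 X)); last first.
  by apply: ler_wpM2r; [exact: schatten1_ge0|exact: expR_ge1Dx].
rewrite mulrDl mul1r mulrDr mulrDl addrA.
apply: le_trans (schatten1D _ _) _; apply: lerD.
  apply: le_trans (schatten1D _ _) _; apply: lerD => //.
  by rewrite schatten1Zr (ger0_norm h0) -mulrA; exact: ler_wpM2l.
rewrite schatten1Zr (ger0_norm (exprn_ge0 2 h0)) -mulrA.
apply: ler_pM => //; rewrite ?exprn_ge0 ?schatten1_ge0//.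
by rewrite expr2 ler_piMr.
Qed.

Lemma euler_iter h n X : 0 <= h <= 1 ->
  schatten1 (iter n (B h) X - iter n (expsuperop h G) X) <=
  n%:R * (h ^+ 2 * (expR c + k)) * expR (h * (c + k)) ^+ n * schatten1 X.
Proof.
move=> h01; have /andP[h0 h1] := h01.
set r := expR (h * (c + k)).
have r1 : 1 <= r.
  by apply: le_trans (expR_ge1Dx _); rewrite lerDl mulr_ge0// addr_ge0.
have r0 : 0 <= r by exact: le_trans r1.
have q0 : 0 <= h ^+ 2 * (expR c + k).
  by rewrite mulr_ge0 ?exprn_ge0 ?addr_ge0 ?expR_ge0.
have expr_le i Y : schatten1 (iter i (expsuperop h G) Y) <= r ^+ i * schatten1 Y.
  elim: i => [|i IH]; first by rewrite expr0 mul1r.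
  rewrite iterS exprS -mulrA; apply: le_trans (exp_bound c0 Gc _ h0) _.
  apply: ler_pM => //; rewrite ?expR_ge0 ?schatten1_ge0//.
  by rewrite ler_expR ler_wpM2l// lerDl.
elim: n => [|n IH]; first by rewrite subrr schatten10 !mul0r.
rewrite !iterS; set U := iter n (B h) X; set V := iter n (expsuperop h G) X.
have -> : B h U - expsuperop h G V = B h (U - V) + (B h V - expsuperop h G V).
  have -> : B h (U - V) = B h U - B h V.
    by rewrite /B GB K_sub !scalerBr !opprD [RHS]addrACA (addrACA U).
  by rewrite addrA subrK.
apply: le_trans (schatten1D _ _) _.
rewrite -natr1 !mulrDl mul1r; apply: lerD.
  apply: le_trans (euler_bound _ h01) _; rewrite -/r (exprS r n).
  apply: le_trans (ler_wpM2l r0 IH) _.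
  by rewrite le_eqVlt; apply/orP; left; apply/eqP; ring.
have -> : B h V - expsuperop h G V =
    (h ^+ 2)%:C *: K V - (expsuperop h G V - (V + h%:C *: G V)).
  by rewrite /B opprB addrA [X in X - _ = _]addrC.
apply: le_trans (schatten1B _ _) _.
have Vle : schatten1 V <= r ^+ n.+1 * schatten1 X.
  apply: le_trans (expr_le n X) _; apply: ler_wpM2r; first exact: schatten1_ge0.
  by rewrite (exprS r n) ler_peMl// exprn_ge0.
apply: le_trans (lerD (_ : _ <= h ^+ 2 * k * schatten1 V)
  (exp_euler c0 Gc V h01)) _.
  rewrite schatten1Zr (ger0_norm (exprn_ge0 2 h0)) -mulrA.
  by apply: ler_wpM2l; [exact: exprn_ge0|exact: Kk].
rewrite -mulrDl -mulrDr [k + _]addrC -[leRHS]mulrA.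
exact: ler_wpM2l.
Qed.

(** The exponential is the limit of Euler steps B h corrected at order h^2, so it
    is positive as soon as these are.  Telescoping n steps of size t / n leaves an
    error of order 1 / n. *)
Lemma exp_psd t X : 0 <= t -> psdmx X -> psdmx (expsuperop t G X).
Proof.
move=> t0 Xp; apply: psd_closed => e e0.
pose D := t * (t * (expR c + k)) * expR (t * (c + k)) * schatten1 X.
have ek : 0 <= expR c + k by rewrite addr_ge0 ?expR_ge0.
have D0 : 0 <= D.
  by rewrite !mulr_ge0 ?expR_ge0 ?schatten1_ge0.
pose n := (maxn (Num.truncn t) (Num.truncn (D / e))).+1.
have tn : t <= n%:R.
  apply: le_trans (ltW (truncnS_gt t)) _; rewrite ler_nat ltnS; exact: leq_maxl.
have Dn : D <= n%:R * e.
  rewrite -ler_pdivrMr//; apply: le_trans (ltW (truncnS_gt _)) _.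
  rewrite ler_nat ltnS; exact: leq_maxr.
have n0 : 0 < n%:R :> R by rewrite ltr0n.
have h01 : 0 <= t / n%:R <= 1 by rewrite divr_ge0//= ler_pdivrMr// mul1r.
have /andP[h0 _] := h01.
exists (iter n (B (t / n%:R)) X).
  elim: n {tn Dn n0 h01} (t / n%:R) h0 => [//|i IH] h h0; rewrite iterS.
  exact: B_psd h0 (IH h h0).
have <- : iter n (expsuperop (t / n%:R) G) X = expsuperop t G X.
  by rewrite (exp_iter G_linear c0 Gc)// mulrC divfK// gt_eqF.
apply: le_trans (euler_iter _ _ h01) _; rewrite -expRM_natl.
have -> : n%:R * ((t / n%:R) ^+ 2 * (expR c + k)) *
    expR (n%:R * (t / n%:R * (c + k))) * schatten1 X = D / n%:R.
  have -> : n%:R * (t / n%:R * (c + k)) = t * (c + k).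
    by field; rewrite gt_eqF.
  by rewrite /D; field; rewrite gt_eqF.
by rewrite ler_pdivrMr// mulrC.
Qed.

Hypothesis G_trace : forall X, \tr (G X) = 0.

(** A positive map that preserves traces is an isometry on positive matrices, and
    a Hermitian matrix is the difference of two of them. *)
Lemma exp_contraction t X : 0 <= t -> X \is hermsymmx ->
  schatten1 (expsuperop t G X) <= schatten1 X.
Proof.
move=> t0 Xh; have [Y [Z [Yp Zp XE nX]]] := herm_jordan Xh.
have E W : psdmx W -> schatten1 (expsuperop t G W) = schatten1 W.
  move=> Wp; apply: complexI.
  apply: etrans (esym (schatten1_psd (exp_psd t0 Wp))) _.
  exact: etrans (exp_trace c0 Gc W t0 G_trace) (schatten1_psd Wp).
have -> : expsuperop t G X = expsuperop t G Y - expsuperop t G Z.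
  by rewrite [in LHS]XE; exact: (expB G_linear c0 Gc _ _ t0).
rewrite [leRHS]nX -(E _ Yp) -(E _ Zp); exact: schatten1B.
Qed.
End positivity.

(** * Numerical constants *)

Section exp_tails.
Context {R : realType}.
Implicit Types x y z : R.

(** n terms of the remainder of the series of exp 2 after its first k terms,
    divided by 2^k / k!. *)
Definition exp_tail k n : R := \sum_(i < n) 2 ^+ i * k`!%:R / (k + i)`!%:R.

Lemma exp_tailS k n :
  exp_tail k n.+1 = 1 + 2 / k.+1%:R * exp_tail k.+1 n.
Proof.
have f0 i : i`!%:R != 0 :> R by rewrite pnatr_eq0 -lt0n fact_gt0.
rewrite /exp_tail big_ord_recl addn0 expr0 mul1r divff//; congr (_ + _).
rewrite mulr_sumr; apply: eq_bigr => i _.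
rewrite !lift0 -addSnnS exprS factS natrM.
move: (f0 (k.+1 + i)%N); move: ((k.+1 + i)`!%:R : R) => A A0.
have k1 : k.+1%:R != 0 :> R by rewrite pnatr_eq0.
by field; rewrite A0 nat1r k1.
Qed.

(** From k = 3 on, consecutive terms are at most halved. *)
Lemma exp_tail_ge3 k n : (3 <= k)%N -> exp_tail k n <= 2.
Proof.
elim: n k => [|n IH] k k3; first by rewrite /exp_tail big_ord0.
rewrite exp_tailS; have := IH _ (leqW k3); set e := exp_tail _ _ => e2.
have k1 : 0 < k.+1%:R :> R by rewrite ltr0n.
have k4 : 2 / k.+1%:R <= 2^-1 :> R.
  by rewrite ler_pdivrMr// mulrC ler_pdivlMr// -natrM ler_nat; lia.
have q0 : 0 <= 2 / k.+1%:R :> R by rewrite divr_ge0.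
move: k4 q0; set q := 2 / _ => k4 q0.
have qe : q * e <= q * 2 by exact: ler_wpM2l.
lra.
Qed.

Lemma exp_tail2 n : exp_tail 2 n <= 7 / 3.
Proof.
case: n => [|n]; first by rewrite /exp_tail big_ord0; lra.
by rewrite exp_tailS; have := @exp_tail_ge3 3 n isT; lra.
Qed.

Lemma exp_tail_ge2 k n : (2 <= k)%N -> exp_tail k n <= 7 / 3.
Proof.
rewrite leq_eqVlt => /orP[/eqP <-|k3]; first exact: exp_tail2.
by have := exp_tail_ge3 n k3; lra.
Qed.

Lemma exp_tail0 n : exp_tail 0 n <= 23 / 3.
Proof.
case: n => [|[|n]].
- by rewrite /exp_tail big_ord0; lra.
- by rewrite /exp_tail big_ord1 addn0 fact0 expr0; lra.
by rewrite !exp_tailS; have := exp_tail2 n; lra.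
Qed.

Lemma exp_sum2_le n y : 0 <= y <= 1 -> exp_sum n (2 * y) <= 23 / 3.
Proof.
move=> /andP[y0 y1]; apply: le_trans (exp_tail0 n); apply: ler_sum => i _.
rewrite fact0 mulr1 add0n; apply: ler_wpM2r; first by rewrite invr_ge0.
rewrite exprMn ler_piMr ?exprn_ge0//; exact: exprn_ile1.
Qed.

Lemma exp_high_terms k n z : (2 <= k)%N -> 0 <= z <= 2 ->
  \sum_(i < n) z ^+ (k + i) / (k + i)`!%:R <= z ^+ k / k`!%:R * (7 / 3).
Proof.
move=> k2 /andP[z0 z2]; have f0 i : 0 < i`!%:R :> R by rewrite ltr0n fact_gt0.
have q0 : 0 <= z ^+ k / k`!%:R by rewrite divr_ge0 ?exprn_ge0.
apply: le_trans (ler_wpM2l q0 (exp_tail_ge2 n k2)).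
rewrite mulr_sumr; apply: ler_sum => i _.
rewrite exprD -[leLHS]mulrA -[z ^+ k / _ * _]mulrA; apply: ler_wpM2l; first exact: exprn_ge0.
have -> : (k`!%:R)^-1 * (2 ^+ i * k`!%:R / (k + i)%N`!%:R) =
    2 ^+ i / (k + i)%N`!%:R :> R.
  by rewrite mulrA [2 ^+ i * _]mulrC mulKf ?gt_eqF.
apply: ler_wpM2r; first by rewrite invr_ge0.
by rewrite lerXn2r ?nnegrE.
Qed.

Lemma sum_bin_fact n k x :
  \sum_(i < n) 'C(i, k)%:R * x ^+ (i - k) / i`!%:R =
  exp_sum (n - k) x / k`!%:R.
Proof.
have f0 i : i`!%:R != 0 :> R by rewrite pnatr_eq0 -lt0n fact_gt0.
have [nk|/ltnW kn] := leqP n k.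
  rewrite /exp_sum (eqP nk) big_ord0 mul0r big1// => i _.
  by rewrite bin_small ?mul0r// (leq_trans (ltn_ord i)).
have nE : n = (k + (n - k))%N by rewrite subnKC.
move: (n - k)%N nE => p ->; rewrite big_split_ord /= big1 ?add0r; last first.
  by move=> i _; rewrite bin_small ?mul0r.
rewrite /exp_sum mulr_suml; apply: eq_bigr => i _.
rewrite addKn -(bin_fact (leq_addr i k)) addKn !natrM.
have B0 : 'C(k + i, k)%:R != 0 :> R by rewrite pnatr_eq0 -lt0n bin_gt0 leq_addr.
by field; rewrite B0 !f0.
Qed.

(** Here (2 m + 2) <= 2 'C(M + 1, m) for m <= M, so that 2 * 23/3 suffices for the
    words with at most M jumps, and 7/3 * 23/3 for the others: both are less
    than 23. *)
Lemma sum_below_binomial M y z : (0 < M)%N -> 0 <= y -> 0 <= z ->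
  \sum_(m < M.+1) (2 * m + 2)%N%:R * (z ^+ m * y ^+ (M.+1 - m)) * (23 / 3) +
    z ^+ M.+1 * (7 / 3) * (23 / 3) <=
  23 * (y + z) ^+ M.+1.
Proof.
move=> M0 y0 z0; rewrite exprDn [in leRHS]big_ord_recr /= subnn expr0 mul1r binn mulr1n.
rewrite mulrDr mulr_sumr; apply: lerD.
  apply: ler_sum => m _; have p0 : 0 <= z ^+ m * y ^+ (M.+1 - m).
    by rewrite mulr_ge0 ?exprn_ge0.
  rewrite -mulr_natr [y ^+ _ * _]mulrC mulrAC -mulrA.
  have mC : (m.+1 <= 'C(M.+1, m))%N.
    rewrite -[X in (X <= _)%N](binSn m); exact: leq_bin2l.
  have : (2 * m + 2)%N%:R * (23 / 3) <= 23 * ('C(M.+1, m))%:R :> R.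
    have : (m.+1)%:R <= ('C(M.+1, m))%:R :> R by rewrite ler_nat.
    have -> : (2 * m + 2)%N%:R = 2 * m.+1%:R :> R by rewrite -natrM; congr _%:R; lia.
    have := ler0n R m.+1; lra.
  move=> h; have := ler_wpM2r p0 h; set p := z ^+ m * _; lra.
have := exprn_ge0 M.+1 z0; lra.
Qed.
End exp_tails.

(** * The local error *)

(** N letters are more than there are in any word produced by the scheme of order
    M. *)
Definition longer_than_boxes M N := forall n m s, (n + m <= M)%N ->
  s \in boxes n.+1 m.+1 -> (degs s + m < N)%N.

Lemma longer_than_boxes_exists M : exists n, longer_than_boxes M (M.+1 + n).
Proof.
exists (2 * M * M.+1 + M)%N => n m s nm sb.
have := degs_boxes sb.
have : (2 * n * m.+1 <= 2 * M * M.+1)%N by rewrite leq_mul//; lia.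
lia.
Qed.

Section local_error.
Context {R : realType} {d : nat}.
Local Notation C := R[i].
Implicit Types (X Y : 'M[C]_d).
Variables (J : 'M[C]_d) (LL : 'M[C]_d -> 'M[C]_d).
Hypothesis LL_linear : linear LL.
Variables (j l : R).
Hypotheses (j0 : 0 <= j) (Jj : opbounded J j) (l0 : 0 <= l).
Hypothesis LLl : forall X, schatten1 (LL X) <= l * schatten1 X.
Hypothesis lj : l <= 2 * j.
Variable dt : R.
Hypotheses (dt0 : 0 <= dt) (dtj : dt * j <= 1).
Local Notation y := (dt * j).
Local Notation z := (dt * l).

(** The terms with exactly m jumps among the first N terms of the exponential
    series. *)
Definition layer P N m X :=
  \sum_(i < N) (dt ^+ i / i`!%:R)%:C *: jumped J LL P m i X.

Lemma taylor_layers G N X : (forall Y, G Y = J *m Y + Y *m J^t* + LL Y) ->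
  taylor G N dt X = \sum_(m < N) layer full N m X.
Proof.
move=> GE; rewrite exchange_big; apply: eq_bigr => i _ /=.
case: N i => [[]//|N] i.
by rewrite (iter_jumped LL_linear X GE (N := N)) ?scaler_sumr// -ltnS.
Qed.

Let yz0 m n : 0 <= z ^+ m * y ^+ n.
Proof. by rewrite mulr_ge0 ?exprn_ge0 ?mulr_ge0. Qed.

Lemma layer_bound N m X :
  schatten1 (layer full N m X) <= z ^+ m / m`!%:R * (23 / 3) * schatten1 X.
Proof.
have y01 : 0 <= y <= 1 by rewrite mulr_ge0.
apply: (@le_trans _ _ (z ^+ m * (\sum_(i < N) 'C(i, m)%:R *
    (2 * y) ^+ (i - m) / i`!%:R) * schatten1 X)); last first.
  apply: ler_wpM2r; first exact: schatten1_ge0.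
  rewrite sum_bin_fact -[leRHS]mulrA; apply: ler_wpM2l.
    by rewrite exprn_ge0 ?mulr_ge0.
  rewrite [leRHS]mulrC; apply: ler_wpM2r; first by rewrite invr_ge0.
  exact: exp_sum2_le.
apply: le_trans (schatten1_sum _ _ _) _; rewrite mulr_sumr mulr_suml.
apply: ler_sum => i _; have ti : 0 <= dt ^+ i / i`!%:R by rewrite divr_ge0 ?exprn_ge0.
rewrite schatten1Zr (ger0_norm ti).
have [im|mi] := ltnP i m.
  rewrite (jumped_small J LL_linear _ X im) schatten10 mulr0.
  by rewrite bin_small// !mul0r mulr0 mul0r.
apply: le_trans (ler_wpM2l ti (jumped_bound LL_linear j0 Jj l0 LLl _ _ _ _)) _.
rewrite le_eqVlt; apply/orP; left; apply/eqP; rewrite natrM natrX.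
have -> : dt ^+ i = dt ^+ (i - m) * dt ^+ m by rewrite -exprD subnK.
by rewrite !exprMn; ring.
Qed.

(** The words lost by the truncation have at least M + 1 letters.  Counting them
    leaves the factor y^(M + 1 - m) z^m / (M + 1)! and a partial sum of
    exp (2 y). *)
Lemma layer_below_bound N M m X : (m <= M)%N ->
  schatten1 (layer full N m X - layer (below (M - m).+1) N m X) <=
  (2 * m + 2)%N%:R * (z ^+ m * y ^+ (M.+1 - m)) / M.+1`!%:R * (23 / 3) *
    schatten1 X.
Proof.
move=> mM; have y01 : 0 <= y <= 1 by rewrite mulr_ge0.
apply: (@le_trans _ _ ((2 * m + 2)%N%:R * (z ^+ m * y ^+ (M.+1 - m)) *
    (\sum_(i < N) 'C(i, M.+1)%:R * (2 * y) ^+ (i - M.+1) / i`!%:R) *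
    schatten1 X)); last first.
  apply: ler_wpM2r; first exact: schatten1_ge0.
  rewrite sum_bin_fact -[leRHS]mulrA; apply: ler_wpM2l; first by rewrite mulr_ge0.
  rewrite [leRHS]mulrC; apply: ler_wpM2r; first by rewrite invr_ge0.
  exact: exp_sum2_le.
rewrite /layer -sumrB; apply: le_trans (schatten1_sum _ _ _) _.
rewrite mulr_sumr mulr_suml.
apply: ler_sum => i _; have ti : 0 <= dt ^+ i / i`!%:R by rewrite divr_ge0 ?exprn_ge0.
rewrite -scalerBr schatten1Zr (ger0_norm ti).
apply: le_trans (ler_wpM2l ti
  (jumped_below_bound LL_linear j0 Jj l0 LLl _ _ _ _)) _.
have -> : ((M - m).+1 + m = M.+1)%N by lia.
have [iM|Mi] := ltnP i M.+1.
  by rewrite bin_small// !muln0 !mul0r !mulr0 mul0r.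
rewrite le_eqVlt; apply/orP; left; apply/eqP; rewrite !natrM natrX.
have -> : (i - m - (M - m).+1 = i - M.+1)%N by lia.
have -> : (i - m = (i - M.+1) + (M.+1 - m))%N by lia.
have -> : dt ^+ i = dt ^+ (i - M.+1) * dt ^+ (M.+1 - m) * dt ^+ m.
  by rewrite -!exprD; congr (_ ^+ _); lia.
by rewrite exprD !exprMn; ring.
Qed.

Lemma jumped_below1 m i X :
  jumped J LL (below 1) m i X = if i == m then iter m LL X else 0.
Proof.
have block1 c Y : block J (below 1) c Y = if c == 0%N then Y else 0.
  rewrite /block big_mkcond big_ord_recl /= /below subn0 /=.
  rewrite big1 ?addr0; last by move=> k _; rewrite /bump.
  by case: c => [|c]/=; rewrite ?bin0 ?scale1r ?sandwich00.
elim: m i => [|m IH] i /=; first by rewrite block1.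
case: i => [|i]; first by rewrite big_ord0.
rewrite big_ord_recl /= block1 eqxx IH subSS subn0 eqSS big1 ?addr0.
  by case: ifP => //; rewrite (LL0 LL_linear).
by move=> c _; rewrite block1.
Qed.

(** When only empty blocks are kept, the jumps alone remain. *)
Lemma layer_below1 N m X : (m < N)%N ->
  layer (below 1) N m X = (dt ^+ m / m`!%:R)%:C *: iter m LL X.
Proof.
move=> mN; rewrite /layer (bigD1 (Ordinal mN))//= jumped_below1 eqxx big1 ?addr0//.
by move=> i im; rewrite jumped_below1 -[_ == m]/(i == Ordinal mN) (negPf im) scaler0.
Qed.

Variable M : nat.
Hypothesis M_gt0 : (0 < M)%N.
Variables (Q : nat -> nat) (w : forall m, 'I_(Q m) -> R).
Variable g : forall m, 'I_(Q m) -> nat -> R.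
Hypothesis w0 : forall m (q : 'I_(Q m)), (0 < m < M)%N -> 0 < w q.
Hypothesis g01 : forall m (q : 'I_(Q m)) i, (0 < m < M)%N -> (i <= m)%N -> 0 <= g q i <= 1.
Hypothesis ex : forall m s, (0 < m < M)%N -> size s = m.+1 ->
  (degs s <= M - m)%N -> quad (@w m) (@g m) s = dirichlet m s.

Definition chain m (h : nat -> R) X :=
  iteri m (fun i Y => flow J (M - m) (dt * h i.+1) (LL Y))
    (flow J (M - m) (dt * h 0%N) X).

Definition scheme_layer m X :=
  (dt ^+ m)%:C *: \sum_(q < Q m) (w q)%:C *: chain m (g q) X.

Definition quad_error m : R :=
  (M - m)`!%:R / M`!%:R * combC M m * (z ^+ m * y ^+ (M - m).+1).

Lemma combC_ge0 m : 0 <= combC M m :> R.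
Proof. by apply: sumr_ge0 => x _; rewrite invr_ge0. Qed.

Lemma quad_error_ge0 m : 0 <= quad_error m.
Proof.
by apply: mulr_ge0; [rewrite !mulr_ge0 ?invr_ge0 ?combC_ge0|exact: yz0].
Qed.

Lemma scheme_layer_bound N m X : longer_than_boxes M N -> (0 < m < M)%N ->
  schatten1 (scheme_layer m X - layer (below (M - m).+1) N m X) <=
  quad_error m * schatten1 X.
Proof.
move=> lN mM; have mleM : (M - m + m <= M)%N by lia.
have -> : scheme_layer m X = (dt ^+ m)%:C *:
    \sum_(s <- boxes (M - m).+1 m.+1)
      (dt ^+ degs s * quad (@w m) (@g m) s / (prod_facts s)%:R)%:C *: word J LL s X.
  congr (_ *: _); under eq_bigr => q _ do
    rewrite /chain (chain_boxes J LL_linear) scaler_sumr.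
  rewrite exchange_big /=; apply: eq_bigr => s _.
  rewrite /quad mulr_sumr mulr_suml rmorph_sum scaler_suml; apply: eq_bigr => q _.
  by rewrite scalerA -rmorphM; congr (_%:C *: _); ring.
case: N lN => [|N] lN.
  by have := lN 0%N 0%N [:: (0, 0)%N] isT isT.
rewrite /quad_error combC_boxes.
apply: (chain_error j0 Jj l0 LL_linear LLl) => // s sb.
- by rewrite -ltnS; exact: lN sb.
- by move=> sn; apply: ex => //; exact: size_boxes sb.
move=> sn; have sz := size_boxes sb.
have -> : M = (M - m + m)%N by lia.
rewrite addnK.
apply: quad_dirichlet_high => //; last exact: ltnW.
- by move=> q; exact: w0.
- by move=> q i im; exact: g01.
- by move=> t st dt'; apply: ex => //; rewrite dt'.
Qed.

(** Without jumps there is only one gap, equal to 1, and the weights agree in all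
    degrees: the truncated flow is exactly its layer. *)
Lemma scheme_layer0 N X : longer_than_boxes M N ->
  flow J M dt X = layer (below M.+1) N 0 X.
Proof.
case: N => [|N] lN; first by have := lN 0%N 0%N [:: (0, 0)%N] isT isT.
have := chain_boxes J LL_linear M dt (fun=> 1) 0 X; rewrite /= mulr1 => ->.
apply/schatten1_arbitrarily_small => e e0; apply: le_trans (ltW e0).
have := chain_error j0 Jj l0 LL_linear LLl (n := M) (m := 0) (N := N)
  (qv := gap_monomial (fun=> 1)) (b := 0) X dt0 dtj.
rewrite expr0 scale1r !mul0r; apply.
- by move=> s sb; rewrite -ltnS; apply: lN sb; rewrite addn0.
- move=> s /size_boxes; case: s => [|p []]// _ _.
  by rewrite /dirichlet big_seq1 /degs /= !addn0 expr1n mulr1 divff.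
move=> s /size_boxes; case: s => [|p []]// _ _.
by rewrite /dirichlet big_seq1 /degs /= !addn0 expr1n mulr1 divff ?subrr ?normr0.
Qed.

(** The unnormalized scheme, for arbitrary J and LL and arbitrary gaps. *)
Definition scheme X := flow J M dt X + \sum_(1 <= m < M) scheme_layer m X
  + (dt ^+ M / M`!%:R)%:C *: iter M LL X.

Definition local_const : R :=
  23 / M.+1`!%:R * (y + z) ^+ M.+1 + \sum_(1 <= m < M) quad_error m.

(** Layer by layer, the scheme is compared with the truncated layer and the
    truncated layer with the full one; the layers with more than M jumps are
    missing from the scheme. *)
Lemma local_error_taylor n G X :
  (forall Y, G Y = J *m Y + Y *m J^t* + LL Y) -> longer_than_boxes M (M.+1 + n) ->
  schatten1 (scheme X - taylor G (M.+1 + n) dt X) <= local_const * schatten1 X.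
Proof.
move=> GE; set N := (M.+1 + n)%N => lN.
have X0 := schatten1_ge0 X.
pose u m := if m == 0%N then flow J M dt X else
  if m == M then (dt ^+ M / M`!%:R)%:C *: iter M LL X else scheme_layer m X.
pose P m := layer (below (M - m).+1) N m X.
pose q m := if (0 < m < M)%N then quad_error m else 0.
have -> : scheme X = \sum_(m < M.+1) u m.
  rewrite big_ord_recr /= {2}/u eqxx (gtn_eqF M_gt0); congr (_ + _).
  rewrite -(big_mkord xpredT u) big_ltn// {1}/u eqxx; congr (_ + _).
  apply: eq_big_nat => m /andP[m1 mM]; rewrite /u gtn_eqF// ltn_eqF//.
rewrite (taylor_layers _ _ GE) big_split_ord /= opprD addrA -sumrB.
have uP m : (m <= M)%N -> schatten1 (u m - P m) <= q m * schatten1 X.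
  move=> mM; rewrite /u /q /P; case: (posnP m) => [->|m0] /=.
    by rewrite mul0r (scheme_layer0 X lN) subn0 subrr schatten10.
  case: eqVneq => [->|mneM] /=.
    rewrite ltnn mul0r subnn layer_below1 ?subrr ?schatten10//.
    by rewrite /N addSn ltnS leq_addr.
  have mltM : (m < M)%N by rewrite ltn_neqAle mneM.
  by rewrite mltM; apply: scheme_layer_bound => //; rewrite m0.
apply: le_trans (schatten1B _ _) _.
apply: (@le_trans _ _ ((\sum_(m < M.+1) (q m + (2 * m + 2)%N%:R *
   (z ^+ m * y ^+ (M.+1 - m)) / M.+1`!%:R * (23 / 3)) +
   \sum_(i < n) z ^+ (M.+1 + i) / (M.+1 + i)`!%:R * (23 / 3)) * schatten1 X)).
  rewrite mulrDl; apply: lerD.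
    apply: le_trans (schatten1_sum _ _ _) _; rewrite mulr_suml.
    apply: ler_sum => m _; have mM : (m <= M)%N by rewrite -ltnS.
    have -> : u m - layer full N m X = (u m - P m) - (layer full N m X - P m).
      by rewrite opprB addrA subrK.
    apply: le_trans (schatten1B _ _) _; rewrite mulrDl.
    by apply: lerD; [exact: uP|exact: layer_below_bound].
  apply: le_trans (schatten1_sum _ _ _) _; rewrite mulr_suml.
  by apply: ler_sum => i _; exact: layer_bound.
apply: ler_wpM2r => //; rewrite big_split /= -!mulr_suml -addrA /local_const addrC.
apply: lerD; last first.
  rewrite -(big_mkord xpredT q) big_ltn// {1}/q /= add0r big_nat_recr//=.
  rewrite {2}/q ltnn andbF addr0; apply: ler_sum_nat => m mM.
  by rewrite /q ifT.
have F0 : 0 < M.+1`!%:R :> R by rewrite ltr0n fact_gt0.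
have z2 : 0 <= z <= 2.
  rewrite mulr_ge0//=; have := ler_wpM2l dt0 lj; rewrite mulrCA.
  by move: dtj; lra.
have h := @exp_high_terms R M.+1 n z M_gt0 z2.
have y0 : 0 <= y by rewrite mulr_ge0.
have z0 : 0 <= z by rewrite mulr_ge0.
have B := sum_below_binomial M_gt0 y0 z0.
rewrite [leRHS]mulrAC ler_pdivlMr// mulrDl.
apply: le_trans B; apply: lerD.
  by rewrite -mulr_suml mulrAC divfK ?gt_eqF.
apply: le_trans (ler_wpM2r (ltW F0) (ler_wpM2r _ h)) _; first by lra.
have -> : z ^+ M.+1 / (M.+1)`!%:R * (7 / 3) * (23 / 3) * (M.+1)`!%:R =
  z ^+ M.+1 * (7 / 3) * (23 / 3) by field; rewrite gt_eqF.
by [].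
Qed.
End local_error.

(** * The global error *)

Section lindblad_semigroup.
Context {R : realType} {d k : nat}.
Local Notation C := R[i].
Variables (H : 'M[C]_d) (L : 'I_k -> 'M[C]_d).
Hypothesis H_herm : H \is hermsymmx.
Implicit Types (X Y : 'M[C]_d) (t h : R).
Local Notation J := (Jeff H L).
Local Notation LL := (jumps L).
Local Notation G := (lindblad H L).
Local Notation j := (opnorm J).
Local Notation l := (superop_norm1 LL).

Lemma lindblad_linear : linear G.
Proof.
move=> z X Y; rewrite !lindbladE// jumps_is_linear mulmxDr mulmxDl.
rewrite -scalemxAr -scalemxAl !scalerDr.
rewrite (addrACA (z *: (J *m X))).
exact: addrACA.
Qed.

Lemma lindblad_bound X : schatten1 (G X) <= (2 * j + l) * schatten1 X.
Proof.
rewrite lindbladE// mulrDl; apply: le_trans (schatten1D _ _) _.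
apply: lerD; last exact: jumps_norm1 L H_herm X.
apply: le_trans (schatten1D _ _) _; rewrite mulr_natl mulr2n mulrDl.
apply: lerD; first exact: schatten1_mull (opbounded_opnorm _).
exact: schatten1_mulr (opbounded_adj (opbounded_opnorm _)).
Qed.

Lemma lindblad_bound_ge0 : 0 <= 2 * j + l.
Proof. by rewrite addr_ge0 ?mulr_ge0 ?opnorm_ge0 ?(jumps_norm1_ge0 L H_herm). Qed.

(** Jeff_adj, by cyclicity of the trace. *)
Lemma lindblad_trace X : \tr (G X) = 0.
Proof.
rewrite lindbladE// !mxtraceD [\tr (X *m _)]mxtrace_mulC -mxtraceD -mulmxDl.
rewrite Jeff_adj// mulNmx raddfN /= mulmx_suml /jumps.
rewrite !(raddf_sum (@mxtrace _ _)) -sumrN -big_split big1// => i _ /=.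
by rewrite -!mulmxA mxtrace_mulC -mulmxA addNr.
Qed.

Let K X := J *m X *m J^t*.

(** Completing the square: the left side is (1 + h J) X (1 + h J)^t* plus h times
    the jump part. *)
Lemma lindblad_euler_psd h X : 0 <= h -> psdmx X ->
  psdmx (X + h%:C *: G X + (h ^+ 2)%:C *: K X).
Proof.
move=> h0 Xp.
have hC : (h%:C *: J)^t* = h%:C *: J^t*.
  by rewrite linearZ /= map_mxZ; congr (_ *: _); exact: conjc_real.
have tc1 : (1%:M + h%:C *: J)^t* = 1%:M + h%:C *: J^t*.
  by rewrite -hC; move: (h%:C *: J) => Z; rewrite linearD /= map_mxD trmx1 map_mx1.
have id (A D Z : 'M[C]_d) :
    X + h%:C *: (A *m X + X *m D + Z) + (h ^+ 2)%:C *: (A *m X *m D) =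
    (1%:M + h%:C *: A) *m X *m (1%:M + h%:C *: D) + h%:C *: Z.
  rewrite !mulmxDl !mulmxDr !mul1mx !mulmx1 -!scalemxAl -!scalemxAr scalerA.
  rewrite -rmorphM -expr2 !scalerDr -!addrA; congr (_ + _).
  rewrite addrCA; congr (_ + _); congr (_ + _).
  by rewrite addrC.
rewrite (lindbladE L H_herm) /K id -tc1.
exact: psdD (psd_conj _ Xp) (psdZ h0 (jumps_psd L Xp)).
Qed.

Let K_bound X : schatten1 (K X) <= j * j * schatten1 X.
Proof.
apply: le_trans (schatten1_mulr _ (opbounded_adj (opbounded_opnorm _))) _; rewrite -mulrA.
by apply: ler_wpM2l; [exact: opnorm_ge0|exact: schatten1_mull (opbounded_opnorm _)].
Qed.

Let K_sub X Y : K (X - Y) = K X - K Y.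
Proof. by rewrite /K mulmxBr mulmxBl. Qed.

Let jj0 : 0 <= j * j. Proof. by rewrite mulr_ge0 ?opnorm_ge0. Qed.

Lemma lindblad_exp_psd t X : 0 <= t -> psdmx X -> psdmx (expsuperop t G X).
Proof.
exact: (exp_psd lindblad_linear lindblad_bound_ge0 lindblad_bound jj0 K_bound
  K_sub lindblad_euler_psd).
Qed.

Lemma lindblad_exp_contraction t X : 0 <= t -> X \is hermsymmx ->
  schatten1 (expsuperop t G X) <= schatten1 X.
Proof.
exact: (exp_contraction lindblad_linear lindblad_bound_ge0 lindblad_bound jj0
  K_bound K_sub lindblad_euler_psd lindblad_trace).
Qed.

Lemma lindblad_exp_trace t X : 0 <= t -> \tr (expsuperop t G X) = \tr X.
Proof.
by move=> t0; exact: (exp_trace lindblad_bound_ge0 lindblad_bound X t0 lindblad_trace).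
Qed.
End lindblad_semigroup.

Section scheme_error.
Context {R : realType} {d k : nat}.
Local Notation C := R[i].
Variables (H : 'M[C]_d) (L : 'I_k -> 'M[C]_d).
Variables (M : nat) (Q : nat -> nat) (w : forall m, 'I_(Q m) -> R)
  (s : forall m, 'I_(Q m) -> m.-tuple R) (dt : R).
Implicit Types (X Y : 'M[C]_d).
Local Notation J := (Jeff H L).
Local Notation LL := (jumps L).
Local Notation G := (lindblad H L).
Local Notation j := (opnorm J).
Local Notation l := (superop_norm1 LL).
Hypotheses (H_herm : H \is hermsymmx) (M_ge1 : (1 <= M)%N).
Hypothesis w_gt0 : forall m, (1 <= m < M)%N -> forall q : 'I_(Q m), 0 < w q.
Hypothesis s_simplex : forall m, (1 <= m < M)%N ->
  forall q : 'I_(Q m), @simplex R m (s q).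
Hypothesis ws_exact : forall m, (1 <= m < M)%N ->
  exact_quadrature (M - m) (@w m) (@s m).
Hypotheses (dt0 : 0 <= dt) (dtj : dt * j <= 1).

Let g m (q : 'I_(Q m)) : nat -> R := gap (s q).

Lemma quad_exact m t : (0 < m < M)%N -> size t = m.+1 ->
  (degs t <= M - m)%N -> quad (@w m) (@g m) t = dirichlet m t.
Proof.
move=> mM sz dm; pose gam := nth 0%N (rev (map deg t)).
have gs : (\sum_(i < m.+1) gam i = degs t)%N by rewrite -sum_rev_nth sz.
have gp : (\prod_(i < m.+1) (gam i)`! = \prod_(p <- t) (deg p)`!)%N.
  by rewrite -prod_rev_nth sz.
have := exact_quadratureE (g := gam) (ws_exact mM); rewrite gs => /(_ dm).
rewrite /dirichlet_const gs gp => h; rewrite /dirichlet -h.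
by apply: eq_bigr => q _; rewrite gap_monomialE sz.
Qed.

Local Notation a := (local_const j l dt M).

Lemma local_error X :
  schatten1 (unnormalized_scheme H L w s M dt X - expsuperop dt G X) <=
  a * schatten1 X.
Proof.
have j0 := opnorm_ge0 J; have l0 := jumps_norm1_ge0 L H_herm.
have [n ln] := longer_than_boxes_exists M.
apply/ler_addgt0Pr => e e0.
have [N hN] := exp_tends_to (lindblad_bound_ge0 L H_herm)
  (lindblad_bound L H_herm) X dt0 e0.
have lN : longer_than_boxes M (M.+1 + (n + N)).
  by move=> n' m' t nm tb; apply: leq_trans (ln _ _ _ nm tb) _; lia.
have h1 := local_error_taylor (jumps_is_linear L) j0 (opbounded_opnorm J) l0
  (jumps_norm1 L H_herm) (jumps_norm1_le L H_herm) dt0 dtj M_ge1 (w := w) (g := g)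
  (fun m q mM => w_gt0 mM q) (fun m q i mM im => gap_simplex (s_simplex mM q) im) quad_exact X
  (lindbladE L H_herm) lN.
have h2 : schatten1 (taylor G (M.+1 + (n + N)) dt X - expsuperop dt G X) <= e.
  by apply: hN; lia.
set A := unnormalized_scheme _ _ _ _ _ _ _.
rewrite -(subrK (taylor G (M.+1 + (n + N)) dt X) A) -addrA.
exact: le_trans (schatten1D _ _) (lerD h1 h2).
Qed.

Lemma truncated_flow_psd n t X : psdmx X -> psdmx (truncated_flow H L n t X).
Proof. by move=> Xp; exact: (psd_conj _ Xp). Qed.

Lemma jump_chain_psd m (t : m.-tuple R) X :
  psdmx X -> psdmx (jump_chain H L M dt t X).
Proof.
move=> Xp.
have h i : psdmx (iteri i
    (fun i Y => truncated_flow H L (M - m) (dt * gap t i.+1) (LL Y))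
    (truncated_flow H L (M - m) (dt * gap t 0) X)).
  elim: i => [|i IH]; first exact: truncated_flow_psd Xp.
  exact: truncated_flow_psd (jumps_psd L IH).
exact: h m.
Qed.

Lemma unnormalized_scheme_psd X :
  psdmx X -> psdmx (unnormalized_scheme H L w s M dt X).
Proof.
move=> Xp; apply: psdD; first apply: psdD; first exact: truncated_flow_psd.
  rewrite big_nat; apply: psd_sum => m mM; apply: psdZ; first exact: exprn_ge0.
  apply: psd_sum => q _; apply: psdZ; first exact/ltW/w_gt0.
  exact: jump_chain_psd.
apply: psdZ; first by rewrite divr_ge0 ?exprn_ge0.
have h i : psdmx (iter i LL X).
  by elim: i => [//|i IH]; rewrite iterS; exact: jumps_psd.
exact: h M.
Qed.

Local Notation A := (normalized_scheme H L w s M dt).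
Local Notation E := (expsuperop dt G).

(** A scheme that lost all the trace would be normalized to 0, in view of
    0^-1 = 0; the bound holds in this case as well. *)
Lemma schatten1_normalize Y : psdmx Y ->
  schatten1 ((\tr Y)^-1 *: Y - Y) <= `|schatten1 Y - 1| /\
  psdmx ((\tr Y)^-1 *: Y) /\
  (schatten1 ((\tr Y)^-1 *: Y) = 1 \/ (\tr Y)^-1 *: Y = 0).
Proof.
move=> Yp; rewrite (schatten1_psd Yp) -fmorphV.
have Yn0 := schatten1_ge0 Y; have [Y0|Y0] := eqVneq (schatten1 Y) 0.
  rewrite Y0 invr0 scale0r sub0r schatten1N Y0.
  by split; [exact: normr_ge0|split; [exact: psd0|right]].
split; last first.
  split; first by apply: psdZ => //; rewrite invr_ge0.
  by left; rewrite schatten1Zr ger0_norm ?invr_ge0// mulVf.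
rewrite -[X in _ - X]scale1r -(rmorph1 (real_complex R)) -scalerBl -rmorphB.
rewrite schatten1Zr -{2}(ger0_norm Yn0) -normrM mulrBl mulVf// mul1r distrC.
exact: lexx.
Qed.

(** The scheme produces density matrices, as long as its trace does not vanish, and
    0 from then on. *)
Definition scheme_state X := psdmx X /\ (schatten1 X = 1 \/ X = 0).

Lemma exp_lindblad0 : E 0 = 0.
Proof.
apply: schatten1_eq0; apply/le_anti; rewrite schatten1_ge0 andbT.
have := exp_bound (lindblad_bound_ge0 L H_herm) (lindblad_bound L H_herm) 0 dt0.
by rewrite schatten10 mulr0.
Qed.

(** The trace of the unnormalized step differs from 1 by at most the local error,
    since the exact flow preserves traces; so normalizing costs the local error
    once more. *)
Lemma normalized_step X : 0 <= a -> scheme_state X ->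
  scheme_state (A X) /\ schatten1 (A X - E X) <= 2 * a.
Proof.
move=> a0 [Xp XS]; have Yp := unnormalized_scheme_psd Xp.
have le := local_error X.
have [norm [Ap AS]] := schatten1_normalize Yp.
split; first by split.
rewrite -/(normalized_scheme H L w s M dt X) in norm.
have X1 : schatten1 X <= 1 by case: XS => ->; rewrite ?schatten10.
have Xa : a * schatten1 X <= a by rewrite ler_piMr.
set Y := unnormalized_scheme H L w s M dt X in le Yp norm.
case: XS => [X1'|X0]; last first.
  rewrite X0 schatten10 mulr0 exp_lindblad0 subr0 -/Y in le.
  have Y0 : Y = 0 by apply: schatten1_eq0; apply/le_anti; rewrite le schatten1_ge0.
  rewrite X0 exp_lindblad0 subr0 /normalized_scheme -X0 -/Y Y0 scaler0 schatten10.
  by rewrite mulr_ge0.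
have Ytr : `|schatten1 Y - 1| <= a.
  have EX1 : \tr (E X) = 1%:C.
    by rewrite (lindblad_exp_trace L H_herm _ dt0) (schatten1_psd Xp) X1'.
  have := normc_tr (Y - E X).
  rewrite raddfB /= (schatten1_psd Yp) EX1 -rmorphB normc_real => h.
  exact: le_trans h (le_trans le Xa).
rewrite -[A X](subrK Y) -addrA mulr_natl mulr2n.
apply: le_trans (schatten1D _ _) (lerD _ _); first exact: le_trans norm Ytr.
exact: le_trans le Xa.
Qed.

(** The exact flow contracts differences of Hermitian matrices, so the errors of
    the steps add up. *)
Lemma global_error n X : 0 <= a -> scheme_state X ->
  scheme_state (iter n A X) /\
  schatten1 (iter n A X - iter n E X) <= n%:R * (2 * a).
Proof.
move=> a0 Xs; elim: n => [|n [IHs IH]].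
  by rewrite mul0r subrr schatten10.
have [s1 e1] := normalized_step a0 IHs; split; first by rewrite iterS.
rewrite !iterS.
have EB := expB (lindblad_linear L H_herm) (lindblad_bound_ge0 L H_herm)
  (lindblad_bound L H_herm) (iter n A X) (iter n E X) dt0.
have -> : A (iter n A X) - E (iter n E X) =
    (A (iter n A X) - E (iter n A X)) + E (iter n A X - iter n E X).
  by rewrite EB addrA subrK.
rewrite -natr1 [leRHS]mulrDl mul1r [leRHS]addrC.
apply: le_trans (schatten1D _ _) _; apply: lerD; first exact: e1.
apply: (le_trans _ IH); apply: (lindblad_exp_contraction L H_herm dt0).
have Ep : psdmx (iter n E X).
  elim: n {IHs IH s1 e1 EB} => [|n IH]; first by case: Xs.
  by rewrite iterS; exact: lindblad_exp_psd.
have [/hermP h1 _] := IHs.1; have [/hermP h2 _] := Ep.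
by apply/hermP; rewrite linearB /= map_mxB h1 h2.
Qed.
End scheme_error.

Theorem theorem6 (R : realType) (d k : nat)
    (H : 'M[R[i]]_d) (L : 'I_k -> 'M[R[i]]_d)
    (M N : nat) (T : R)
    (Q : nat -> nat) (w : forall m, 'I_(Q m) -> R)
    (s : forall m, 'I_(Q m) -> m.-tuple R)
    (H_herm : H \is hermsymmx)
    (M_ge1 : (1 <= M)%N) (N_gt0 : (0 < N)%N) (T_gt0 : 0 < T)
    (w_gt0 : forall m, (1 <= m < M)%N -> forall q : 'I_(Q m), 0 < w m q)
    (s_simplex : forall m, (1 <= m < M)%N ->
       forall q : 'I_(Q m), @simplex R m (s m q))
    (ws_exact : forall m, (1 <= m < M)%N ->
       exact_quadrature (M - m) (w m) (s m))
    (dt_le : ((T / N%:R)%:E <= (opnorm (Jeff H L))%:E^-1)%E)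
    (rho : 'M[R[i]]_d) (rho_density : density_matrix rho) :
  schatten1 (iter N (normalized_scheme H L w s M (T / N%:R)) rho
             - expsuperop T (lindblad H L) rho)
  <= error_const H L M * (T ^+ M.+1 / N%:R ^+ M).
Proof.
set dt := T / N%:R in dt_le *.
have N0 : 0 < N%:R :> R by rewrite ltr0n.
have dt0 : 0 <= dt by rewrite divr_ge0 ?ltW.
have j0 := opnorm_ge0 (Jeff H L).
have l0 := jumps_norm1_ge0 L H_herm.
have dtj : dt * opnorm (Jeff H L) <= 1.
  move: dt_le; rewrite inver; case: eqP => [->|/eqP jn0]; first by rewrite mulr0.
  have jp : 0 < opnorm (Jeff H L) by rewrite lt_def jn0 j0.
  by rewrite lee_fin -(ler_pdivlMr _ _ jp) div1r.
set a := local_const (opnorm (Jeff H L)) (superop_norm1 (jumps L)) dt M.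
have rho1 : schatten1 rho = 1.
  by apply: complexI; rewrite -(schatten1_psd rho_density.1) rho_density.2.
have rho_state : scheme_state rho by split; [exact: rho_density.1|left].
have a0 : 0 <= a.
  have := local_error H_herm M_ge1 w_gt0 s_simplex ws_exact dt0 dtj rho.
  by rewrite rho1 mulr1; apply: le_trans; exact: schatten1_ge0.
have [_ err] := global_error H_herm M_ge1 w_gt0 s_simplex ws_exact dt0 dtj N
  a0 rho_state.
have TE : expsuperop T (lindblad H L) rho =
    iter N (expsuperop dt (lindblad H L)) rho.
  rewrite (exp_iter (lindblad_linear L H_herm) (lindblad_bound_ge0 L H_herm)
    (lindblad_bound L H_herm) N rho dt0) /dt.
  by rewrite mulrC divfK// gt_eqF.
rewrite TE; apply: le_trans err _.
have -> : T ^+ M.+1 / N%:R ^+ M = N%:R * dt ^+ M.+1.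
  rewrite /dt expr_div_n [N%:R ^+ M.+1]exprS invfM.
  by rewrite [RHS]mulrCA mulVKf// gt_eqF.
rewrite [leRHS]mulrCA; apply: ler_wpM2l; first exact: ltW.
rewrite /a /local_const /error_const [leRHS]mulrDl [leLHS]mulrDr; apply: lerD.
  by rewrite -mulrDr exprMn le_eqVlt; apply/orP; left; apply/eqP; ring.
rewrite mulr_sumr mulr_suml; apply: ler_sum_nat => m /andP[m1 mM].
have q0 := quad_error_ge0 j0 l0 dt0 M m.
apply: (@le_trans _ _ (4 * quad_error (opnorm (Jeff H L))
  (superop_norm1 (jumps L)) dt M m)); first by apply: ler_wpM2r => //; lra.
rewrite /quad_error addn1 le_eqVlt; apply/orP; left; apply/eqP.
have -> : dt ^+ M.+1 = dt ^+ m * dt ^+ (M - m).+1 by rewrite -exprD; congr (_ ^+ _); lia.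
by rewrite !exprMn; ring.
Qed.
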